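(* Assume that for every $t>0$ the operator $P^{\tau_{\mathcal O}}_t h(x)=\mathbb{E}^x\{1_{\{t<\tau_{\mathcal O}\}}h(X(t))\}$ maps the space of continuous bounded functions $E\to\mathbb{R}$ into itself. Then the functions $w^\beta(s,x)$ increase pointwise to $w(s,x)$ as $\beta\to\infty$.
   Context: Setting. $E$ is a locally compact separable space with a metric $\rho$ for which every closed ball is compact. $(X(t))_{t\ge0}$ is a standard Markov process on $E$ (strong Markov, càdlàg, quasi-left-continuous, with complete right-continuous filtration) with laws $\mathbb{P}^x$ and expectations $\mathbb{E}^x$, $x\in E$. It is weakly Feller: $P_t\mathcal C_0\subseteq\mathcal C_0$, where $P_th(x)=\mathbb{E}^x\{h(X(t))\}$ and $\mathcal C_0$ is the space of continuous bounded functions $E\to\mathbb{R}$ vanishing at infinity. $\mathcal O\subset E$ is an open set and $\tau_{\mathcal O}=\inf\{t\ge0: X(t)\notin\mathcal O\}$. $\alpha>0$, and $f,G,H:[0,\infty)\times E\to\mathbb{R}$ are continuous bounded functions. For $(s,x)\in[0,\infty)\times E$ and a stopping time $\tau$ (possibly infinite), $$J(s,x,\tau)=\mathbb{E}^x\Big\{\int_0^{\tau\wedge\tau_{\mathcal O}}e^{-\alpha u}f(s+u,X(u))\,du+1_{\{\tau<\tau_{\mathcal O}\}}e^{-\alpha\tau}G(s+\tau,X(\tau))+1_{\{\tau\ge\tau_{\mathcal O}\}}e^{-\alpha\tau_{\mathcal O}}H(s+\tau_{\mathcal O},X(\tau_{\mathcal O}))\Big\},$$ where discounted terminal payoffs at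 an infinite time are read as $0$. The value function is $w(s,x)=\sup_\tau J(s,x,\tau)$, the supremum being over all stopping times. For $\beta>0$, $w^\beta$ denotes the unique bounded measurable function on $[0,\infty)\times E$ satisfying $$w^\beta(s,x)=\mathbb{E}^x\Big\{\int_0^{\tau_{\mathcal O}}e^{-\alpha u}\big[f+\beta(G-w^\beta)^+\big](s+u,X(u))\,du+e^{-\alpha\tau_{\mathcal O}}H(s+\tau_{\mathcal O},X(\tau_{\mathcal O}))\Big\}.$$ *)

(* Defs.v *)
From HB Require Import structures.
From mathcomp Require Import all_boot all_order all_algebra.
From mathcomp Require Import all_classical all_reals all_analysis.
From mathcomp Require Import measurable_realfun.

Set Implicit Arguments.
Unset Strict Implicit.
Unset Printing Implicit Defensive.

Import Order.TTheory GRing.Theory Num.Theory.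
Import numFieldNormedType.Exports.

Local Open Scope classical_set_scope.
Local Open Scope ring_scope.

(* The library builds the generated sigma-algebra on pointed types only, hence
   the join with [Pointed]. *)
#[short(type="pmetricType")]
HB.structure Definition PMetric (R : numDomainType) :=
  {M of Pointed M & Metric R M}.

Definition borel (R : realType) (E : pmetricType R) :=
  g_sigma_algebraType (@open E).

Section spaces.
Context (R : realType) (E : pmetricType R).

Definition separable_space := exists2 D : set E, countable D & dense D.

Definition closed_balls_compact :=
  forall (x : E) (r : R), compact [set y | mdist x y <= r].

Definition Cb (h : E -> R) :=
  continuous h /\ exists M : R, forall x, `|h x| <= M.

Definition C0 (h : E -> R) :=
  Cb h /\ forall e : R, 0 < e ->
    exists2 K : set E, compact K & forall x, ~ K x -> `|h x| < e.

(* Functions on [0, oo) x E are total functions on R * E of which only the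
   restriction to [half_space] is ever used. *)
Definition half_space : set (R * E) := `[0, +oo[ `*` [set: E].

Definition bounded_half_space (g : R * E -> R) :=
  exists M : R, forall s x, 0 <= s -> `|g (s, x)| <= M.

Definition Cb_half_space (g : R * E -> R) :=
  {within half_space, continuous g} /\ bounded_half_space g.

End spaces.

Section filtrations.
Context (R : realType) (d : measure_display) (Omega : measurableType d).
Implicit Types (F : R -> set (set Omega)) (tau : Omega -> \bar R).

Definition filtration F :=
  (forall t, 0 <= t -> sigma_algebra setT (F t) /\ F t `<=` measurable) /\
  (forall s t, 0 <= s -> s <= t -> F s `<=` F t).

Definition right_continuous_filtration F :=
  forall t, 0 <= t -> F t = \bigcap_(u in `]t, +oo[) F u.

Definition stopping_time F tau :=
  (forall w, 0 <= tau w)%E /\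
  forall t : R, 0 <= t -> F t [set w | (tau w <= t%:E)%E].

Definition stopped_sigma_algebra F tau : set (set Omega) :=
  [set A | measurable A /\
    forall t : R, 0 <= t -> F t (A `&` [set w | (tau w <= t%:E)%E])].

End filtrations.

(* A conservative process: paths stay in E for all times. Times are reals, and
   [F t], [X t], [theta t] are only used for t >= 0. *)
Section markov.
Context (R : realType) (E : pmetricType R).
Context (d : measure_display) (Omega : measurableType d).
Implicit Types (P : E -> probability Omega R) (F : R -> set (set Omega)).
Implicit Types (X : R -> Omega -> E) (theta : R -> Omega -> Omega).

(* The sigma-algebra generated by the X(t), t >= 0. *)
Definition sigma_paths X : set (set Omega) :=
  <<s [set A | exists t : R, 0 <= t /\
        exists2 B : set (borel E), measurable B & A = X t @^-1` B] >>.

(* The probability of [N] when X(0) is distributed according to [mu]; the map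
   integrated is nonnegative, and universally measurable in general. *)
Definition initial_law P (mu : probability (borel E) R) (N : set Omega)
  : \bar R := (\int[mu]_x P x N)%E.

(* [F t] coincides with the intersection over the initial distributions [mu]
   of its completions with respect to the law of the process started from
   [mu]. *)
Definition complete_filtration P F :=
  forall t : R, 0 <= t -> forall A : set Omega,
    (forall mu : probability (borel E) R,
       exists2 B : set Omega, F t B &
       exists N : set Omega, [/\ measurable N, initial_law P mu N = 0%E &
         (A `\` B) `|` (B `\` A) `<=` N]) ->
    F t A.

Definition adapted F X :=
  forall t : R, 0 <= t -> forall B : set (borel E), measurable B ->
    F t (X t @^-1` B).

Definition cadlag X :=
  forall w, (forall t : R, 0 <= t -> X s w @[s --> t^'+] --> X t w) /\
            (forall t : R, 0 < t -> exists l : E, X s w @[s --> t^'-] --> l).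

Definition strong_markov P F X theta :=
  forall tau, stopping_time F tau ->
  forall A, stopped_sigma_algebra F tau A ->
  forall Y : Omega -> R,
    (forall B : set R, measurable B -> sigma_paths X (Y @^-1` B)) ->
    (exists M : R, forall w, `|Y w| <= M) ->
  forall x,
    \int[P x]_(w in A `&` [set w | (tau w < +oo)%E])
       Y (theta (fine (tau w)) w) =
    \int[P x]_(w in A `&` [set w | (tau w < +oo)%E])
       \int[P (X (fine (tau w)) w)]_v Y v.

Definition quasi_left_continuous P F X :=
  forall (taus : nat -> Omega -> \bar R) (tau : Omega -> \bar R),
    (forall n, stopping_time F (taus n)) ->
    (forall n w, taus n w <= taus n.+1 w)%E ->
    (forall w, tau w = ereal_sup (range (taus ^~ w))) ->
  forall x, {ae P x, forall w, (tau w < +oo)%E ->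
    X (fine (taus n w)) w @[n --> \oo] --> X (fine (tau w)) w}.

Record standard_markov_process P F X theta : Prop := {
  smp_filtration : filtration F ;
  smp_right_continuous : right_continuous_filtration F ;
  smp_complete : complete_filtration P F ;
  smp_adapted : adapted F X ;
  smp_cadlag : cadlag X ;
  smp_shift : forall (s t : R) w, 0 <= s -> 0 <= t ->
    X s (theta t w) = X (t + s) w ;
  smp_kernel : forall A, sigma_paths X A ->
    measurable_fun setT ((fun x => P x A) : borel E -> \bar R) ;
  smp_start : forall x, P x [set w | X 0 w = x] = 1%E ;
  smp_strong_markov : strong_markov P F X theta ;
  smp_quasi_left_continuous : quasi_left_continuous P F X
}.

Definition semigroup P X (t : R) (h : E -> R) (x : E) : R :=
  \int[P x]_w h (X t w).

Definition weakly_feller P X :=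
  forall t : R, 0 <= t -> forall h, C0 h -> C0 (semigroup P X t h).

Definition exit_time X (O : set E) (w : Omega) : \bar R :=
  ereal_inf (EFin @` [set t : R | 0 <= t /\ ~ O (X t w)]).

Definition killed_semigroup P X O (t : R) (h : E -> R) (x : E) : R :=
  \int[P x]_w (if (t%:E < exit_time X O w)%E then h (X t w) else 0).

End markov.

Section stopping_problem.
Context (R : realType) (E : pmetricType R).
Context (d : measure_display) (Omega : measurableType d).
Implicit Types (P : E -> probability Omega R) (F : R -> set (set Omega)).
Implicit Types (X : R -> Omega -> E) (O : set E) (alpha : R).
Implicit Types (f g G H : R * E -> R) (T : \bar R).

Definition running X alpha g (s : R) T (w : Omega) : R :=
  \int[lebesgue_measure]_(u in [set u : R | 0 <= u /\ (u%:E <= T)%E])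
    (expR (- alpha * u) * g (s + u, X u w)).

(* A discounted payoff at an infinite time is 0. *)
Definition terminal X alpha g (s : R) T (w : Omega) : R :=
  if T is t%:E then expR (- alpha * t) * g (s + t, X t w) else 0.

Definition J P X O alpha f G H (s : R) (x : E) (tau : Omega -> \bar R) : R :=
  \int[P x]_w
    (running X alpha f s (Order.min (tau w) (exit_time X O w)) w +
     (if (tau w < exit_time X O w)%E then terminal X alpha G s (tau w) w
      else terminal X alpha H s (exit_time X O w) w)).

Definition value P F X O alpha f G H (s : R) (x : E) : R :=
  sup [set J P X O alpha f G H s x tau | tau in stopping_time F].

Definition penalized_solution P X O alpha f G H (beta : R) (v : R * E -> R) :=
  [/\ measurable_fun (@half_space R E : set (R * borel E))
        (v : R * borel E -> R),
      bounded_half_space v &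
      forall s x, 0 <= s ->
        v (s, x) = \int[P x]_w
          (running X alpha
             (fun z => f z + beta * Num.max (G z - v z) 0) s
             (exit_time X O w) w +
           terminal X alpha H s (exit_time X O w) w)].

End stopping_problem.

(* Main.v *)
Require Import Defs.
From HB Require Import structures.
From mathcomp Require Import all_boot all_order all_algebra.
From mathcomp Require Import all_classical all_reals all_analysis.
From mathcomp Require Import measurable_realfun.
From mathcomp Require Import ring lra.

Set Implicit Arguments.
Unset Strict Implicit.
Unset Printing Implicit Defensive.

Import Order.TTheory GRing.Theory Num.Theory.
Import numFieldNormedType.Exports.

Local Open Scope classical_set_scope.
Local Open Scope ring_scope.

(* Let [v = w^beta] and [g = f + beta (G - v)^+], and write processes discounted
   along the path of [X]. Replacing the exit time by the almost surely equal
   time [T] at which the hitting times of shrinking open neighbourhoods of the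
   complement of [O] accumulate, the simple Markov property at deterministic
   times says that [v] is the value of the running payoff [g] up to [T] followed
   by [H], at every time [t < T].
   - Monotonicity: for [b1 <= b2] and [D = w^b1 - w^b2], the running payoffs
     differ by at most [b1 D^-]. Evaluating [D] at a time chosen uniformly
     between 0 and [1/b1] makes the resulting error vanish on average, so a bound
     [D <= delta] improves to [D <= q delta] with [q < 1].
   - [w^beta <= w]: the same choice of a deterministic time, at which one stops
     if [G >= v] and continues otherwise, yields by iteration stopping times
     whose payoff is within [C q^n] of [v].
   - Every payoff is at most [sup_beta w^beta]: boundedness of [v] makes the mean
     of [int (G - v)^+] of order [1/beta], so every cell of a time grid contains
     a time at which [G <= v] up to a small mean error. By right-continuity of
     the paths it suffices to approximate a stopping time from the right by
     stopping times with values in such times. *)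

(** * Bounded measurable functions and integrals along a path *)

(** The value [v] is handled as a merely bounded measurable function, so the first time at which
    [G >= v] along a path is not a usable stopping rule. Hence [v] is only evaluated at
    deterministic times, and conditional expectations become integrals over events of [F t]. The
    window length [1/beta] is forced: on it, [beta] times the integral of a function is its mean, so
    the penalty over the window cancels the mean shortfall at a uniform time. The factor [q] comes
    from discounting alone. It tends to 1 as [beta] grows, which is harmless since each iteration
    runs at a fixed [beta]. In the last bound the error is summed over the grid cells, so [beta] is
    chosen last, after the mesh and the number of cells. The detour through [T] has two causes: the
    exit time from an open set is the hitting time of a closed one, which a countable set of times
    does not detect, and the Markov property only concerns functionals measurable for the paths. *)

Section bounded_integrals.
Context (R : realType) (d : measure_display) (S : measurableType d).
Context (P : probability S R).
Implicit Types (f g : S -> R) (A B : set S).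

Definition bounded_measurable f :=
  measurable_fun setT f /\ exists M : R, forall w, `|f w| <= M.

Lemma bmD f g : bounded_measurable f -> bounded_measurable g ->
  bounded_measurable (fun w => f w + g w).
Proof.
move=> [mf [M fM]] [mg [N gN]]; split; first exact: measurable_funD.
by exists (M + N) => w; rewrite (le_trans (ler_normD _ _))// lerD.
Qed.

Lemma bmZ f (c : R) : bounded_measurable f ->
  bounded_measurable (fun w => c * f w).
Proof.
move=> [mf [M fM]]; split; first exact: measurable_funM.
by exists (`|c| * M) => w; rewrite normrM ler_wpM2l.
Qed.

Lemma bmB f g : bounded_measurable f -> bounded_measurable g ->
  bounded_measurable (fun w => f w - g w).
Proof.
move=> bf /(bmZ (-1)) bg; have := bmD bf bg.
by under eq_fun do rewrite mulN1r.
Qed.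

Lemma bm_if (b : S -> bool) f g : measurable_fun setT b ->
  bounded_measurable f -> bounded_measurable g ->
  bounded_measurable (fun w => if b w then f w else g w).
Proof.
move=> mb [mf [M fM]] [mg [N gN]]; split; first exact: measurable_fun_ifT.
by exists (Num.max M N) => w; case: ifP => _; rewrite le_max ?fM ?gN// orbT.
Qed.

Lemma bm_cst (c : R) : bounded_measurable (fun=> c).
Proof. by split=> //; exists `|c|. Qed.

Lemma bm_integrable f A : measurable A -> bounded_measurable f ->
  P.-integrable A (EFin \o f).
Proof.
move=> mA [mf [M fM]]; apply: measurable_bounded_integrable => //.
- by rewrite (le_lt_trans (probability_le1 P mA))// ltry.
- exact: measurable_funTS.
- exists M; split; first exact: num_real.
  by move=> x Mx w _ /=; rewrite (le_trans (fM w))// ltW.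
Qed.

Lemma bm_RintegralD f g A : measurable A -> bounded_measurable f ->
  bounded_measurable g ->
  \int[P]_(w in A) (f w + g w) = \int[P]_(w in A) f w + \int[P]_(w in A) g w.
Proof. by move=> mA bf bg; rewrite RintegralD//; exact: bm_integrable. Qed.

Lemma bm_RintegralB f g A : measurable A -> bounded_measurable f ->
  bounded_measurable g ->
  \int[P]_(w in A) (f w - g w) = \int[P]_(w in A) f w - \int[P]_(w in A) g w.
Proof. by move=> mA bf bg; rewrite RintegralB//; exact: bm_integrable. Qed.

Lemma bm_RintegralZ f A (c : R) : measurable A -> bounded_measurable f ->
  \int[P]_(w in A) (c * f w) = c * \int[P]_(w in A) f w.
Proof. by move=> mA bf; rewrite RintegralZl//; exact: bm_integrable. Qed.

Lemma bm_le_Rintegral f g A : measurable A -> bounded_measurable f ->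
  bounded_measurable g -> (forall w, A w -> f w <= g w) ->
  \int[P]_(w in A) f w <= \int[P]_(w in A) g w.
Proof. by move=> mA bf bg fg; apply: le_Rintegral => //; exact: bm_integrable. Qed.

Lemma bm_Rintegral_le_cst f A (c : R) : measurable A -> bounded_measurable f ->
  0 <= c -> (forall w, A w -> f w <= c) -> \int[P]_(w in A) f w <= c.
Proof.
move=> mA bf c0 fc; apply: (@le_trans _ _ (\int[P]_(w in A) c)).
  by apply: bm_le_Rintegral => //; exact: bm_cst.
rewrite Rintegral_cst// ler_piMr//.
rewrite -[1]/(fine 1%E) fine_le ?fin_numElt ?ltry ?ltNyr//.
- by rewrite (lt_le_trans _ (measure_ge0 _ _)) ?ltNyr//=
    (le_lt_trans (probability_le1 P mA))// ltry.
- exact: probability_le1.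
Qed.

Lemma bm_RintegralI f A B : measurable A -> measurable B ->
  bounded_measurable f ->
  \int[P]_(w in A) f w =
  \int[P]_(w in A `&` B) f w + \int[P]_(w in A `\` B) f w.
Proof.
move=> mA mB bf; rewrite -{1}(setUIDK A B) setDE Rintegral_setU//.
- exact: measurableI.
- by apply: measurableI => //; exact: measurableC.
- by apply: bm_integrable => //; rewrite -setDE setUIDK.
- by apply/disj_setPS => w [[_ Bw] [_]].
Qed.

End bounded_integrals.

Section segments.
Context (R : realType).
Notation mu := (@lebesgue_measure R).
Implicit Types (a t : R) (b : \bar R) (phi psi : R -> R).

(** Half-open, so that consecutive segments are disjoint and [r] lies in [seg t (T w)] exactly when
    [t <= r] and [T] is not yet reached; [b] is extended because [T] may be infinite. *)
Definition seg t b : set R := [set r | t <= r /\ (r%:E < b)%E].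

Lemma segE t b : seg t b = match b with
  | r%:E => `[t, r[%classic | +oo%E => `[t, +oo[%classic | -oo%E => set0 end.
Proof.
rewrite /seg; case: b => [r| |]; apply/seteqP; split => x /=.
- by rewrite in_itv/= lte_fin => -[-> ->].
- by rewrite in_itv/= lte_fin => /andP[].
- by rewrite in_itv/= => -[-> _].
- by rewrite in_itv/= andbT ltry.
- by rewrite ltNge leNye => -[].
- by [].
Qed.

Lemma measurable_seg t b : measurable (seg t b : set (measurableTypeR R)).
Proof. by rewrite segE; case: b => [r| |]//; exact: measurable_itv. Qed.

Lemma seg_split t u b : t <= u -> (u%:E <= b)%E ->
  seg t b = seg t u%:E `|` seg u b.
Proof.
move=> tu ub; apply/seteqP; split => r /=.
  move=> [tr rb]; have [ru|ur] := ltP r u; [left|right]; split => //.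
move=> [[tr ru]|[ur rb]]; split => //; last exact: le_trans ur.
exact: lt_le_trans ru ub.
Qed.

Lemma seg_disj t u b : [disjoint seg t u%:E & seg u b].
Proof.
by apply/disj_setPS => r [[_ ru] [ur _]]; move: ru; rewrite lte_fin ltNge ur.
Qed.

End segments.

Section path_integrals.
Context (R : realType) (alpha : R).
Hypothesis alpha_gt0 : 0 < alpha.
Notation mu := (@lebesgue_measure R).
Implicit Types (a t : R) (b : \bar R) (phi psi : R -> R).

Definition Itg phi t b : R := \int[mu]_(r in seg t b) phi r.

Definition damped phi := measurable_fun setT phi /\
  exists C : R, forall r, 0 <= r -> `|phi r| <= C * expR (- alpha * r).

Lemma expR_integrable b :
  mu.-integrable (seg 0 b) (EFin \o (fun r => expR (- alpha * r))).
Proof.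
have m0 := measurable_seg 0 b.
(* On the half-line the discount factor is the exponential density divided by [alpha]. *)
have i0 : mu.-integrable setT (EFin \o exponential_pdf alpha).
  exact: integrable_exponential_pdf.
have := integrableS (mu := mu) measurableT m0 (@subsetT _ _) i0.
move=> /(integrableZl m0 alpha^-1); apply: eq_integrable => // r.
rewrite inE => -[r0 _] /=; rewrite exponential_pdfE//.
by rewrite -EFinM mulrA mulVf ?mul1r// gt_eqF.
Qed.

Lemma damped_integrable phi t b : 0 <= t -> damped phi ->
  mu.-integrable (seg t b) (EFin \o phi).
Proof.
move=> t0 [mphi [C phiC]].
have mt := measurable_seg t b; have m0 := measurable_seg 0 b.
have sub : seg t b `<=` seg 0 b by move=> r [tr rb]; split => //; exact: le_trans tr.
have := integrableS m0 mt sub (expR_integrable b).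
move=> /(integrableZl mt C); apply: le_integrable => //.
  by apply/measurable_EFinP; exact: measurable_funTS.
move=> r [tr _] /=; rewrite lee_fin (le_trans (phiC r _)) ?(le_trans t0)//.
exact: ler_norm.
Qed.

(** [K] is the total mass of the discount factor on the half-line. One constant serves all
    integrands and intervals, so the resulting bounds are uniform over the paths. *)
Lemma Itg_bound : exists2 K : R, 0 <= K & forall phi C t b, 0 <= t ->
  measurable_fun setT phi ->
  (forall r, 0 <= r -> `|phi r| <= C * expR (- alpha * r)) ->
  `|Itg phi t b| <= C * K.
Proof.
exists (Itg (fun r => expR (- alpha * r)) 0 +oo%E).
  by apply: Rintegral_ge0 => r _; exact: expR_ge0.
move=> phi C t b t0 mphi phiC.
have dphi : damped phi by split => //; exists C.
have mt := measurable_seg t b; have m0 := @measurable_seg R 0 +oo%E.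
have sub : seg t b `<=` seg 0 +oo%E.
  by move=> r [tr rb]; split; [exact: le_trans tr|rewrite ltry].
have C0 : 0 <= C.
  by have := phiC 0 (lexx _); rewrite mulr0 expR0 mulr1; exact: le_trans.
rewrite /Itg (le_trans (le_normr_Rintegral _ _))//.
  exact: damped_integrable.
have eC : mu.-integrable (seg 0 +oo%E) (EFin \o (fun r => C * expR (- alpha * r))).
  exact: integrableZl (expR_integrable _).
rewrite -RintegralZl//; last exact: expR_integrable.
apply: (@le_trans _ _ (\int[mu]_(r in seg t b) (C * expR (- alpha * r)))).
  apply: le_Rintegral => //.
  - exact/integrable_norm/damped_integrable.
  - exact: integrableS eC.
  - by move=> r [tr _]; apply: phiC; exact: le_trans tr.
apply: fine_le.
- by apply: integrable_fin_num => //; exact: integrableS eC.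
- exact: integrable_fin_num.
- apply: ge0_subset_integral => //.
    by case/integrableP: eC.
  by move=> r _; rewrite lee_fin mulr_ge0// expR_ge0.
Qed.

Lemma Itg_split phi t u b : 0 <= t -> damped phi -> t <= u -> (u%:E <= b)%E ->
  Itg phi t b = Itg phi t u%:E + Itg phi u b.
Proof.
move=> t0 dphi tu ub; rewrite /Itg (seg_split tu ub) Rintegral_setU//.
- exact: measurable_seg.
- exact: measurable_seg.
- by rewrite -seg_split//; exact: damped_integrable.
- exact: seg_disj.
Qed.

Lemma le_Itg phi psi t b : 0 <= t -> damped phi -> damped psi ->
  (forall r, 0 <= r -> phi r <= psi r) -> Itg phi t b <= Itg psi t b.
Proof.
move=> t0 dphi dpsi le; apply: le_Rintegral.
- exact: measurable_seg.
- exact: damped_integrable.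
- exact: damped_integrable.
- by move=> r [tr _]; apply: le; exact: le_trans tr.
Qed.

Lemma ItgD phi psi t b : 0 <= t -> damped phi -> damped psi ->
  Itg (fun r => phi r + psi r) t b = Itg phi t b + Itg psi t b.
Proof.
move=> t0 dphi dpsi; apply: RintegralD.
- exact: measurable_seg.
- exact: damped_integrable.
- exact: damped_integrable.
Qed.

Lemma ItgB phi psi t b : 0 <= t -> damped phi -> damped psi ->
  Itg (fun r => phi r - psi r) t b = Itg phi t b - Itg psi t b.
Proof.
move=> t0 dphi dpsi; apply: RintegralB.
- exact: measurable_seg.
- exact: damped_integrable.
- exact: damped_integrable.
Qed.

Lemma ItgZ phi c t b : 0 <= t -> damped phi ->
  Itg (fun r => c * phi r) t b = c * Itg phi t b.
Proof.
move=> t0 dphi; apply: RintegralZl; first exact: measurable_seg.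
exact: damped_integrable.
Qed.

Lemma le_Itg_seg phi t u b b' : 0 <= t -> damped phi ->
  (forall r, 0 <= r -> 0 <= phi r) -> t <= u -> (b <= b')%E ->
  Itg phi u b <= Itg phi t b'.
Proof.
move=> t0 dphi phi0 tu bb'.
have mu' := measurable_seg u b; have mt := measurable_seg t b'.
have sub : seg u b `<=` seg t b'.
  by move=> r [ur rb]; split; [exact: le_trans ur|exact: lt_le_trans bb'].
have phii := damped_integrable b' t0 dphi.
apply: fine_le.
- by apply: integrable_fin_num => //; exact: integrableS phii.
- exact: integrable_fin_num.
- apply: ge0_subset_integral => //; first by case/integrableP: phii.
  by move=> r [tr _]; rewrite lee_fin phi0// (le_trans t0).
Qed.

Lemma lebesgue_measure_seg t u : t <= u ->
  lebesgue_measure (seg t u%:E) = (u - t)%:E.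
Proof.
move=> tu; rewrite segE lebesgue_measure_itv/= lte_fin; case: ltP => // ut.
by rewrite (le_anti (introT andP (conj ut tu))) subrr.
Qed.

Lemma Itg_cst t u (k : R) : t <= u -> Itg (fun=> k) t u%:E = k * (u - t).
Proof.
move=> tu; rewrite /Itg Rintegral_cst; last exact: measurable_seg.
by congr (_ * _); rewrite [X in fine X]lebesgue_measure_seg.
Qed.

Lemma cst_integrable t u (k : R) : t <= u ->
  mu.-integrable (seg t u%:E) (EFin \o (fun=> k)).
Proof.
move=> tu; apply: measurable_bounded_integrable => //.
- exact: measurable_seg.
- by rewrite [X in (X < _)%E]lebesgue_measure_seg// ltry.
- exists `|k|; split; first exact: num_real.
  by move=> x kx r _ /=; exact: ltW.
Qed.

Lemma Itg_fin_ler phi C t u : 0 <= t -> t <= u -> damped phi ->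
  (forall r, 0 <= r -> `|phi r| <= C) ->
  `|Itg phi t u%:E| <= C * (u - t).
Proof.
move=> t0 tu dphi phiC.
have mt := measurable_seg t u%:E.
rewrite /Itg (le_trans (le_normr_Rintegral _ _))//; first exact: damped_integrable.
rewrite -Itg_cst//; apply: le_Rintegral => //.
- exact/integrable_norm/damped_integrable.
- exact: cst_integrable.
- by move=> r [tr _]; apply: phiC; exact: le_trans tr.
Qed.

Lemma Itg0 phi t b : (b <= t%:E)%E -> Itg phi t b = 0.
Proof.
move=> bt; rewrite /Itg (_ : seg t b = set0) ?Rintegral_set0//.
by apply/seteqP; split => // r [tr rb]; move: (lt_le_trans rb bt);
   rewrite lte_fin ltNge tr.
Qed.

Lemma exists_lt_mean phi t u k : t < u ->
  mu.-integrable (seg t u%:E) (EFin \o phi) ->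
  Itg phi t u%:E < k * (u - t) -> exists r, [/\ t <= r, r < u & phi r < k].
Proof.
move=> tu phii; rewrite ltNge => /negP /[dup] nle _; apply: contrapT => /forallNP no.
apply: nle.
rewrite -Itg_cst ?(ltW tu)//; apply: le_Rintegral => //.
- exact: measurable_seg.
- exact: cst_integrable (ltW tu).
- move=> r [tr]; rewrite lte_fin => ru; rewrite leNgt; apply/negP => phik.
  by apply: (no r); split.
Qed.

End path_integrals.

(** * Processes with discounted bounds *)

Section processes.
Context (R : realType) (d : measure_display) (Omega : measurableType d).
Notation mu := (@lebesgue_measure R).
Implicit Types (t u : R) (tau : Omega -> \bar R) (phi : R -> Omega -> R).

Definition jointly_measurable phi :=
  measurable_fun setT (fun p : measurableTypeR R * Omega => phi p.1 p.2).

Lemma jointly_measurable_section1 phi w :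
  jointly_measurable phi -> measurable_fun setT (phi ^~ w).
Proof.
move=> mphi.
exact: (measurableT_comp mphi (measurable_fun_pair (@measurable_id _ _ _) (measurable_cst w))).
Qed.

Lemma jointly_measurable_section2 phi t :
  jointly_measurable phi -> measurable_fun setT (phi t).
Proof.
move=> mphi.
exact: (measurableT_comp mphi (measurable_fun_pair (measurable_cst t) (@measurable_id _ _ _))).
Qed.

Lemma measurable_joint_seg t tau : measurable_fun setT tau ->
  measurable [set p : measurableTypeR R * Omega | seg t (tau p.2) p.1].
Proof.
move=> mtau.
have mE : measurable_fun setT (fun p : measurableTypeR R * Omega => p.1%:E).
  by apply/measurable_EFinP; exact: measurable_fst.
have mt : measurable_fun setT (fun p : measurableTypeR R * Omega => tau p.2).
  exact: measurableT_comp.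
have := measurable_lte measurableT mE mt.
have : measurable ([set: measurableTypeR R * Omega] `&` fst @^-1` `[t, +oo[%classic).
  by apply: measurable_fst => //; exact: measurable_itv.
move=> /measurableI /[apply]; rewrite !setTI; congr measurable.
by apply/seteqP; split => p /=; rewrite in_itv/= andbT.
Qed.

Let joint phi t tau : measurableTypeR R * Omega -> R :=
  (fun p => phi p.1 p.2) \_ [set p | seg t (tau p.2) p.1].

Let jointE phi t tau r w : joint phi t tau (r, w) = ((phi ^~ w) \_ (seg t (tau w))) r.
Proof. by rewrite /joint !patchE; congr (if _ then _ else _); rewrite !inE. Qed.

Let mjoint phi t tau : jointly_measurable phi -> measurable_fun setT tau ->
  measurable_fun setT (joint phi t tau).
Proof.
move=> mphi mtau; apply/(measurable_restrictT _ (measurable_joint_seg t mtau)).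
exact: measurable_funTS.
Qed.

(** The random end point is absorbed into an indicator on the product space; Tonelli then applies to
    the positive and negative parts. *)
Lemma measurable_Itg phi t tau : jointly_measurable phi ->
  measurable_fun setT tau ->
  measurable_fun setT (fun w => Itg (phi ^~ w) t (tau w)).
Proof.
move=> mphi mtau.
have -> : (fun w => Itg (phi ^~ w) t (tau w)) =
    fun w => fine (\int[mu]_r (EFin \o joint phi t tau) (r, w))%E.
  apply/funext => w; rewrite /Itg Rintegral_mkcond; congr fine.
have mj : measurable_fun setT (EFin \o joint phi t tau).
  by apply/measurable_EFinP; exact: mjoint.
apply: (measurableT_comp (fine_measurable measurableT)).
have -> : (fun w => \int[mu]_r (EFin \o joint phi t tau) (r, w))%E =
    (fun w => \int[mu]_r (EFin \o joint phi t tau)^\+ (r, w) -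
              \int[mu]_r (EFin \o joint phi t tau)^\- (r, w))%E.
  by apply/funext => w; rewrite integralE; congr (_ - _)%E;
    apply: eq_integral => r _; rewrite ?funeposE ?funenegE.
apply: emeasurable_funB.
- by apply: (@measurable_fun_fubini_tonelli_G _ _ _ _ _ mu) => //; exact: measurable_funepos.
- by apply: (@measurable_fun_fubini_tonelli_G _ _ _ _ _ mu) => //; exact: measurable_funeneg.
Qed.

Variable (P : probability Omega R).

Variable (alpha : R).
Hypothesis alpha_gt0 : 0 < alpha.

Definition process phi := jointly_measurable phi /\
  exists C : R, forall r w, 0 <= r -> `|phi r w| <= C * expR (- alpha * r).

Lemma process_damped phi w : process phi -> damped alpha (phi ^~ w).
Proof.
move=> [mphi [C phiC]]; split; first exact: jointly_measurable_section1.
by exists C => r; exact: phiC.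
Qed.

Lemma process_bm phi t : 0 <= t -> process phi -> bounded_measurable (phi t).
Proof.
move=> t0 [mphi [C phiC]]; split; first exact: jointly_measurable_section2.
by exists (C * expR (- alpha * t)) => w; exact: phiC.
Qed.

Lemma process_Itg_bm phi t tau : 0 <= t -> process phi ->
  measurable_fun setT tau ->
  bounded_measurable (fun w => Itg (phi ^~ w) t (tau w)).
Proof.
move=> t0 [mphi [C phiC]] mtau; split; first exact: measurable_Itg.
have [K _ KP] := Itg_bound alpha_gt0.
exists (C * K) => w; apply: KP => //; first exact: jointly_measurable_section1.
by move=> r; exact: phiC.
Qed.

Lemma damped_mean phi : process phi -> (forall r w, 0 <= phi r w) ->
  damped alpha (fun r => \int[P]_w phi r w).
Proof.
move=> [mphi [C phiC]] phi0; split.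
  have mE : measurable_fun setT
      (EFin \o (fun p : measurableTypeR R * Omega => phi p.1 p.2)).
    exact/measurable_EFinP.
  apply: (measurableT_comp (fine_measurable measurableT)).
  apply: (@measurable_fun_fubini_tonelli_F _ _ _ _ _ P _ mE).
  by move=> p; rewrite lee_fin.
have C0 : 0 <= C.
  have := phiC 0 point (lexx _); rewrite mulr0 expR0 mulr1; exact: le_trans.
exists C => r r0; rewrite ger0_norm; last by apply: Rintegral_ge0.
apply: bm_Rintegral_le_cst => //.
- by apply: process_bm => //; split => //; exists C.
- by rewrite mulr_ge0// expR_ge0.
- by move=> w _; rewrite (le_trans _ (phiC r w r0))// ler_norm.
Qed.

Lemma mean_Itg phi t b : 0 <= t -> process phi -> (forall r w, 0 <= phi r w) ->
  \int[P]_w Itg (phi ^~ w) t b = Itg (fun r => \int[P]_w phi r w) t b.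
Proof.
move=> t0 pphi phi0; have [mphi [C phiC]] := pphi.
pose g := EFin \o joint phi t (fun=> b).
have mg : measurable_fun setT g by apply/measurable_EFinP; exact: mjoint.
have g0 p : (0 <= g p)%E.
  by rewrite /g /joint /= patchE; case: ifP => // _; rewrite lee_fin.
have gE r w : g (r, w) = ((EFin \o phi ^~ w) \_ (seg t b)) r.
  by rewrite /g /= jointE !patchE; case: ifP.
rewrite {1}/Rintegral [in RHS]/Itg [in RHS]/Rintegral; congr fine.
transitivity (\int[P]_w \int[mu]_r g (r, w))%E.
  apply: eq_integral => w _; rewrite /Itg /Rintegral fineK.
    by rewrite integral_mkcond; apply: eq_integral => r _; rewrite gE.
  apply: integrable_fin_num; first exact: measurable_seg.
  exact: damped_integrable alpha_gt0 _ _ _ t0 (process_damped w pphi).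
rewrite -(@fubini_tonelli _ _ _ _ _ mu P _ mg g0) [RHS]integral_mkcond.
apply: eq_integral => r _; rewrite patchE; case: ifPn => rt.
  transitivity (\int[P]_w (phi r w)%:E)%E.
    by apply: eq_integral => w _; rewrite gE patchE rt.
  rewrite /= /Rintegral fineK//; apply: integrable_fin_num => //.
  apply: bm_integrable => //; apply: process_bm => //.
  by move: rt; rewrite inE => -[tr _]; exact: le_trans tr.
by apply: integral0_eq => w _; rewrite gE patchE (negbTE rt).
Qed.

End processes.

(** * Choice of a deterministic time *)

Section discount.
Context (R : realType) (alpha : R).
Hypothesis alpha_gt0 : 0 < alpha.

Lemma damped_expR : damped alpha (fun r => expR (- alpha * r)).
Proof.
split; last by exists 1 => r _; rewrite mul1r ger0_norm ?expR_ge0.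
apply: measurableT_comp; first exact: measurable_expR.
exact: measurable_funM.
Qed.

Lemma Itg_expR t u : t < u -> 0 <= t ->
  Itg (fun r => expR (- alpha * r)) t u%:E =
  alpha^-1 * (expR (- alpha * t) - expR (- alpha * u)).
Proof.
move=> tu t0; have a0 : alpha != 0 by rewrite gt_eqF.
pose F : R -> R := fun x => - alpha^-1 * expR (- alpha * x).
have dF (x : R) : is_derive x (1 : R) F (expR (- alpha * x)).
  rewrite [X in is_derive _ _ _ X](_ : _ = - alpha^-1 *: (expR (- alpha * x) * (- alpha * 1))).
    by apply: is_deriveZ.
  by rewrite /GRing.scale/=; field.
have cF : continuous F.
  by move=> x; apply/differentiable_continuous/derivable1_diffP; have [] := dF x.
have := damped_integrable alpha_gt0 u%:E t0 damped_expR.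
rewrite /Itg segE => ii; rewrite Rintegral_itv_bndo_bndc//.
rewrite /Rintegral (@continuous_FTC2 _ _ F)//=.
- by rewrite /F; ring.
- apply: continuous_subspaceT => x.
  apply: continuous_comp; last exact: continuous_expR.
  by apply: continuousM => //; exact: cst_continuous.
- split => [x _||].
  + by have [] := dF x.
  + by apply: cvg_at_right_filter; exact: cF.
  + by apply: cvg_at_left_filter; exact: cF.
- by move=> x _; rewrite derive1E; have [_ ->] := dF x.
Qed.

(** In both applications [c] is the penalization, [z r] the mean of a positive part on the event
    that [T] lies after [r], and [K] the current error bound. The window of integration does not
    depend on the time [u] to be found. *)
Definition discounted_time (c q : R) := forall (z : R -> R) (t K : R),
  0 <= t -> damped alpha z -> 0 < K -> exists u, [/\ t <= u, u < t + c^-1 &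
    c * Itg z t (t + c^-1)%:E - z u + K * expR (- alpha * u) <=
    q * K * expR (- alpha * t)].

(* A time chosen uniformly at random in [t, t + 1/c] makes the average of
   [c * Itg z - z u] vanish, while discounting loses a fixed factor [q]. *)
Lemma exists_discounted_time c : 0 < c ->
  exists2 q : R, 0 < q < 1 & discounted_time c q.
Proof.
move=> c0; pose y := alpha / c.
have y0 : 0 < y by rewrite divr_gt0.
(* [q0] is the mean of the discount factor over a uniform time in [0, 1/c]. *)
pose q0 := (1 - expR (- y)) / y.
have q01 : q0 < 1.
  rewrite /q0 ltr_pdivrMr// mul1r ltrBlDr -ltrBlDl.
  by rewrite expR_gt1Dx// oppr_eq0 gt_eqF.
have q00 : 0 < q0 by rewrite divr_gt0// subr_gt0 expR_lt1 oppr_lt0.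
(* The midpoint of [q0] and 1 leaves the strict gap needed by [exists_lt_mean] and stays below 1. *)
exists ((q0 + 1) / 2); first lra.
move=> z t K t0 dz K0; set h := c^-1; have h0 : 0 < h by rewrite invr_gt0.
have th : t < t + h by rewrite ltrDl.
pose I := Itg z t (t + h)%:E.
pose phi r := (c * I - z r) + K * expR (- alpha * r).
have mt := measurable_seg t (t + h)%:E.
have iz := damped_integrable alpha_gt0 (t + h)%:E t0 dz.
have ie := damped_integrable alpha_gt0 (t + h)%:E t0 damped_expR.
have ic := cst_integrable (c * I) (ltW th).
have iB : lebesgue_measure.-integrable (seg t (t + h)%:E) (EFin \o (fun r => c * I - z r)).
  exact: (integrableB mt ic iz).
have iK : lebesgue_measure.-integrable (seg t (t + h)%:E)
    (EFin \o (fun r => K * expR (- alpha * r))).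
  exact: (integrableZl mt K ie).
have iphi : lebesgue_measure.-integrable (seg t (t + h)%:E) (EFin \o phi).
  exact: (integrableD mt iB iK).
have Iphi : Itg phi t (t + h)%:E = K * h * q0 * expR (- alpha * t).
  transitivity (Itg (fun=> c * I) t (t + h)%:E - Itg z t (t + h)%:E +
      K * Itg (fun r => expR (- alpha * r)) t (t + h)%:E).
    rewrite [LHS](RintegralD mt iB iK); congr (_ + _).
      exact: (RintegralB mt ic iz).
    exact: (RintegralZl K mt ie).
  rewrite Itg_cst ?ltW// Itg_expR// -/I.
  have -> : c * I * (t + h - t) = I by rewrite addrC addrA addNr add0r mulrAC /h mulfV ?mul1r// gt_eqF.
  have -> : - alpha * (t + h) = - alpha * t + - y by rewrite /y /h; ring.
  rewrite subrr add0r expRD /q0.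
  have -> : h = y / alpha by rewrite /y /h mulrAC mulfV ?mul1r// gt_eqF.
  by field; rewrite !gt_eqF.
have [|u [tu uh phiu]] := @exists_lt_mean _ phi t (t + h)
  ((q0 + 1) / 2 * K * expR (- alpha * t)) th iphi.
  have X0 : 0 < K * h * expR (- alpha * t) by rewrite !mulr_gt0 ?expR_gt0.
  rewrite Iphi -subr_gt0.
  have -> : (q0 + 1) / 2 * K * expR (- alpha * t) * (t + h - t) -
      K * h * q0 * expR (- alpha * t) =
      (1 - q0) / 2 * (K * h * expR (- alpha * t)) by field.
  by rewrite mulr_gt0// divr_gt0// subr_gt0.
exists u; split => //; exact: ltW.
Qed.

End discount.

(** * Operations on processes, and killing at a random time *)

Section process_operations.
Context (R : realType) (d : measure_display) (Omega : measurableType d).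
Context (alpha : R).
Implicit Types (phi psi : R -> Omega -> R).
Local Notation process := (process alpha).

Lemma processD phi psi : process phi -> process psi ->
  process (fun r w => phi r w + psi r w).
Proof.
move=> [mphi [C phiC]] [mpsi [D psiD]]; split; first exact: measurable_funD.
exists (C + D) => r w r0; rewrite (le_trans (ler_normD _ _))// mulrDl lerD//.
- exact: phiC.
- exact: psiD.
Qed.

Lemma processZ phi (c : R) : process phi -> process (fun r w => c * phi r w).
Proof.
move=> [mphi [C phiC]]; split; first exact: measurable_funM.
by exists (`|c| * C) => r w r0; rewrite normrM -mulrA ler_wpM2l// phiC.
Qed.

Lemma processB phi psi : process phi -> process psi ->
  process (fun r w => phi r w - psi r w).
Proof.
move=> pphi /(processZ (-1)) /(processD pphi).
by under eq_fun do under eq_fun do rewrite mulN1r.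
Qed.

Lemma process_max0 phi : process phi -> process (fun r w => Num.max (phi r w) 0).
Proof.
move=> [mphi [C phiC]]; split; first exact: measurable_maxr.
exists C => r w r0; rewrite (le_trans _ (phiC r w r0))//.
by rewrite ger0_norm ?le_max ?lexx ?orbT// ge_max normr_ge0 ler_norm.
Qed.

Variables (A : set Omega) (T : Omega -> \bar R).
Hypotheses (mA : measurable A) (mT : measurable_fun setT T).

(** Moves the event [A] and the random horizon [T] into the integrand, so that Fubini is only needed
    over a deterministic interval. *)
Definition killed phi (r : R) := phi r \_ (A `&` [set w | (r%:E < T w)%E]).

Lemma measurable_ltT (t : R) : measurable [set w | (t%:E < T w)%E].
Proof. by rewrite -[X in measurable X]setTI; exact: emeasurable_fun_o_infty. Qed.

Lemma process_killed phi : process phi -> process (killed phi).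
Proof.
move=> [mphi [C phiC]]; split.
  rewrite /jointly_measurable.
  have mlt : measurable [set p : measurableTypeR R * Omega | (p.1%:E < T p.2)%E].
    rewrite -[X in measurable X]setTI; apply: measurable_lte => //.
      by apply/measurable_EFinP; exact: measurable_fst.
    exact: measurableT_comp.
  have mS : measurable [set p : measurableTypeR R * Omega |
      A p.2 /\ (p.1%:E < T p.2)%E].
    apply: measurableI => //; rewrite -[X in measurable X]setTI.
    exact: measurable_snd.
  rewrite (_ : (fun p => _) = (fun p : measurableTypeR R * Omega => phi p.1 p.2)
      \_ [set p | A p.2 /\ (p.1%:E < T p.2)%E]).
    by apply/(measurable_restrictT _ mS); exact: measurable_funTS.
  apply/funext => p; rewrite /killed !patchE.
  by congr (if _ then _ else _); apply/idP/idP; rewrite !inE.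
exists C => r w r0; rewrite /killed patchE; case: ifP => _; first exact: phiC.
by rewrite normr0 (le_trans _ (phiC r w r0)).
Qed.

Lemma Itg_killed phi t b w : Itg (killed phi ^~ w) t b =
  ((fun w => Itg (phi ^~ w) t (mine b (T w))) \_ A) w.
Proof.
rewrite patchE; case: ifPn => wA; last first.
  rewrite /Itg; under eq_Rintegral => r _.
    rewrite /killed patchE ifF; last first.
      by apply/negbTE; apply: contra wA; rewrite !inE => -[].
    over.
  by rewrite Rintegral_cst ?mul0r//; exact: measurable_seg.
rewrite /Itg [LHS]Rintegral_mkcond [RHS]Rintegral_mkcond.
apply: eq_Rintegral => r _; rewrite /killed !patchE.
have -> : (r \in seg t (mine b (T w))) =
    (r \in seg t b) && (w \in A `&` [set w | (r%:E < T w)%E]).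
  apply/idP/andP; rewrite !inE /seg/=.
    by rewrite lt_min => -[tr /andP[rb rT]]; move: wA; rewrite inE.
  by move=> [[tr rb] [_ rT]]; rewrite lt_min rb.
by case: (r \in _) => //=; case: ifP.
Qed.

Variable P : probability Omega R.
Hypothesis alpha_gt0 : 0 < alpha.

Lemma mean_Itg_min phi t b : 0 <= t -> process phi ->
  (forall r w, 0 <= phi r w) ->
  \int[P]_(w in A) Itg (phi ^~ w) t (mine b (T w)) =
  Itg (fun r => \int[P]_(w in A `&` [set w | (r%:E < T w)%E]) phi r w) t b.
Proof.
move=> t0 pphi phi0; rewrite Rintegral_mkcond.
under eq_Rintegral do rewrite -Itg_killed.
rewrite (mean_Itg _ alpha_gt0)//; last first.
- by move=> r w; rewrite /killed patchE; case: ifP.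
- exact: process_killed.
by apply: eq_Rintegral => r _; rewrite [RHS]Rintegral_mkcond.
Qed.

Lemma damped_killed_mean phi : process phi -> (forall r w, 0 <= phi r w) ->
  damped alpha (fun r => \int[P]_(w in A `&` [set w | (r%:E < T w)%E]) phi r w).
Proof.
move=> pphi phi0.
under eq_fun do rewrite Rintegral_mkcond.
apply: damped_mean => //; first exact: process_killed.
by move=> r w; rewrite /killed patchE; case: ifP.
Qed.

End process_operations.

(** * Filtrations and stopping times *)

Section stopping_times.
Context (R : realType) (d : measure_display) (Omega : measurableType d).
Context (F : R -> set (set Omega)).
Hypothesis filF : filtration F.
Implicit Types (t u : R) (A B : set Omega) (tau : Omega -> \bar R).

Lemma filtration_measurable t A : 0 <= t -> F t A -> measurable A.
Proof. by move=> t0; apply: (filF.1 t t0).2. Qed.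

Lemma filtrationW s t A : 0 <= s -> s <= t -> F s A -> F t A.
Proof. by move=> s0 st; exact: filF.2. Qed.

Lemma filtrationC t A : 0 <= t -> F t A -> F t (~` A).
Proof. by move=> t0 FA; rewrite -setTD; have [[_ + _] _] := filF.1 t t0; exact. Qed.

Lemma filtration0 t : 0 <= t -> F t set0.
Proof. by move=> t0; have [[]] := filF.1 t t0. Qed.

Lemma filtrationT t : 0 <= t -> F t setT.
Proof. by move=> t0; rewrite -setC0; apply: filtrationC => //; exact: filtration0. Qed.

Lemma filtration_bigcup t (A : (set Omega)^nat) : 0 <= t ->
  (forall n, F t (A n)) -> F t (\bigcup_n A n).
Proof. by move=> t0; have [[_ _ +] _] := filF.1 t t0; exact. Qed.

Lemma filtration_bigcap t (A : (set Omega)^nat) : 0 <= t ->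
  (forall n, F t (A n)) -> F t (\bigcap_n A n).
Proof.
move=> t0 FA; rewrite -[X in F t X]setCK setC_bigcap.
by apply/filtrationC/filtration_bigcup => // n; exact: filtrationC.
Qed.

Lemma filtrationI t A B : 0 <= t -> F t A -> F t B -> F t (A `&` B).
Proof.
move=> t0 FA FB; rewrite -bigcap2E; apply: filtration_bigcap => // -[|[|n]]//=.
exact: filtrationT.
Qed.

Lemma filtrationU t A B : 0 <= t -> F t A -> F t B -> F t (A `|` B).
Proof.
move=> t0 FA FB; rewrite -bigcup2E; apply: filtration_bigcup => // -[|[|n]]//=.
exact: filtration0.
Qed.

Lemma stopping_timeC tau t : stopping_time F tau -> 0 <= t ->
  F t [set w | (t%:E < tau w)%E].
Proof.
move=> [_ stau] t0; have := filtrationC t0 (stau t t0); congr F.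
by apply/seteqP; split => w /=; rewrite ltNge => /negP.
Qed.

Lemma measurable_from_gt tau :
  (forall t, measurable [set w | (t%:E < tau w)%E]) -> measurable_fun setT tau.
Proof.
move=> mtau; apply: (measurability _ (ErealGenOInfty.measurableE R)).
move=> _ [_ [r ->] <-]; rewrite setTI; have := mtau r; congr measurable.
by apply/seteqP; split => w /=; rewrite in_itv/= andbT.
Qed.

Lemma stopping_time_measurable tau : stopping_time F tau -> measurable_fun setT tau.
Proof.
move=> st; apply: measurable_from_gt => t; have [t0|t0] := leP 0 t.
  exact: filtration_measurable t0 (stopping_timeC st t0).
rewrite (_ : [set w | _] = setT)//; apply/seteqP; split => // w _ /=.
by rewrite (lt_le_trans _ (st.1 w))// lte_fin.
Qed.

Lemma stopping_time_cst u : 0 <= u -> stopping_time F (fun=> u%:E).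
Proof.
move=> u0; split => [w|t t0]; first by rewrite lee_fin.
have [ut|tu] := leP u%:E t%:E.
  by rewrite (_ : [set w | _] = setT)//; [exact: filtrationT|apply/seteqP].
rewrite (_ : [set w | _] = set0)//; first exact: filtration0.
by apply/seteqP; split => // w /=; rewrite leNgt tu.
Qed.

(** The choice between stopping at [u] and continuing with [tau] is made at time [u]; since [tau] is
    at least [u], nothing has been stopped before the choice is known. *)
Lemma stopping_time_splice u A tau : 0 <= u -> F u A -> stopping_time F tau ->
  (forall w, (u%:E <= tau w)%E) ->
  stopping_time F (fun w => if w \in A then tau w else u%:E).
Proof.
move=> u0 FA stau utau; split => [w|t t0].
  by case: ifP => _; [exact: stau.1|rewrite lee_fin].
have [ut|tu] := leP u t; last first.
  rewrite (_ : [set w | _] = set0); first exact: filtration0.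
  apply/seteqP; split => // w /=; case: ifP => _; rewrite leNgt ?lte_fin ?tu//.
  by rewrite (lt_le_trans _ (utau w))// lte_fin.
rewrite (_ : [set w | _] = A `&` [set w | (tau w <= t%:E)%E] `|` ~` A).
  apply: filtrationU => //.
    by apply: filtrationI => //; [exact: filtrationW FA|exact: stau.2].
  by apply: filtrationC => //; exact: filtrationW FA.
apply/seteqP; split => [w|w] /=.
  by case: ifPn => [/set_mem wA wt|/negP wA _]; [left|right => /mem_set].
move=> [[Aw]|Aw]; first by rewrite mem_set.
by rewrite ifF ?lee_fin//; apply/negP; rewrite inE.
Qed.

End stopping_times.

(** * Penalized dynamics *)

Section penalized_dynamics.
Context (R : realType) (d : measure_display) (Omega : measurableType d).
Context (P : probability Omega R) (alpha : R) (F : R -> set (set Omega)).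
Context (T : Omega -> \bar R) (h : Omega -> R).
Hypotheses (alpha_gt0 : 0 < alpha) (filF : filtration F).
Hypotheses (stT : stopping_time F T) (bmh : bounded_measurable h).
Implicit Types (t u : R) (A B : set Omega) (tau : Omega -> \bar R).
Implicit Types (f g v G : R -> Omega -> R).
Local Notation process := (process alpha).

Let mT : measurable_fun setT T := stopping_time_measurable filF stT.

Let mltT u : measurable [set w | (u%:E < T w)%E] := measurable_ltT mT u.

Let mminT (b : \bar R) : measurable_fun setT (fun w => mine b (T w)).
Proof. exact: measurable_mine. Qed.

Let bltT u : measurable_fun setT (fun w => (u%:E < T w)%E).
Proof. exact: measurable_fun_lte. Qed.

(* On [t < T], [v t] is the conditional expectation given [F t] of the payoff
   collected after [t]. *)
Definition dynamics g v := forall t A, 0 <= t -> F t A ->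
  A `<=` [set w | (t%:E < T w)%E] ->
  \int[P]_(w in A) v t w = \int[P]_(w in A) (Itg (g ^~ w) t (T w) + h w).

(** Dynamic programming at the deterministic time [u]: [dynamics] is applied to [A] restricted to
    [u < T], and on the rest both sides agree pathwise. The event only has to belong to [F u], not
    to [F t], because the payoff on [t, u) is the same on both sides. *)
Lemma dynamics_upto g v t u A : process g -> process v -> dynamics g v ->
  0 <= t -> t <= u -> F u A ->
  \int[P]_(w in A) (Itg (g ^~ w) t (T w) + h w) = \int[P]_(w in A)
    (Itg (g ^~ w) t (mine u%:E (T w)) + (if (u%:E < T w)%E then v u w else h w)).
Proof.
move=> pg pv gv t0 tu FA; have u0 : 0 <= u by exact: le_trans tu.
have mA := filtration_measurable filF u0 FA.
set B := [set w | (u%:E < T w)%E].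
have mB : measurable B by exact: mltT.
have mAB : measurable (A `&` B) by exact: measurableI.
have FAB : F u (A `&` B).
  by apply: filtrationI => //; exact: stopping_timeC.
have bI r : 0 <= r -> bounded_measurable (fun w => Itg (g ^~ w) r (T w)).
  by move=> r0; exact: (process_Itg_bm alpha_gt0 r0 pg mT).
have bIm : bounded_measurable (fun w => Itg (g ^~ w) t (mine u%:E (T w))).
  exact: (process_Itg_bm alpha_gt0 t0 pg (mminT _)).
have bvu := process_bm u0 pv.
rewrite (bm_RintegralI P mA mB); last by apply: bmD => //; exact: bI.
rewrite [RHS](bm_RintegralI P mA mB); last by apply: bmD => //; exact: bm_if.
congr (_ + _); last first.
  apply: eq_Rintegral => w; rewrite inE => -[_ /negP]; rewrite -leNgt => Tu.
  by rewrite min_r// ltNge Tu.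
transitivity (\int[P]_(w in A `&` B)
    (Itg (g ^~ w) t (mine u%:E (T w)) + (Itg (g ^~ w) u (T w) + h w))).
  apply: eq_Rintegral => w; rewrite inE => -[_ /= uT].
  rewrite (Itg_split alpha_gt0 t0 (process_damped w pg) tu (ltW uT)) min_l ?ltW//.
  by rewrite addrA.
rewrite bm_RintegralD//; last by apply: bmD => //; exact: bI.
rewrite -gv//.
rewrite -bm_RintegralD//; apply: eq_Rintegral => w; rewrite inE => -[_ /= uT].
by rewrite uT.
Qed.

Definition penalized f G v (beta : R) : R -> Omega -> R :=
  fun r w => f r w + beta * Num.max (G r w - v r w) 0.

Definition shortfall G v : R -> Omega -> R :=
  fun r w => Num.max (G r w - v r w) 0.

Lemma process_shortfall G v : process G -> process v -> process (shortfall G v).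
Proof. by move=> pG pv; apply/process_max0/processB. Qed.

Lemma process_penalized f G v beta : process f -> process G -> process v ->
  process (penalized f G v beta).
Proof.
by move=> pf pG pv; apply: processD => //; apply/processZ/process_shortfall.
Qed.

Lemma shortfall_ge0 G v r w : 0 <= shortfall G v r w.
Proof. by rewrite /shortfall le_max lexx orbT. Qed.

Lemma shortfallP G v r w : G r w <= v r w + shortfall G v r w.
Proof. by rewrite /shortfall -lerBlDl le_max lexx. Qed.

Lemma Itg_penalized f G v beta t b w : 0 <= t -> process f -> process G ->
  process v -> Itg (penalized f G v beta ^~ w) t b =
  Itg (f ^~ w) t b + beta * Itg (shortfall G v ^~ w) t b.
Proof.
move=> t0 pf pG pv.
have dZ := process_damped w (process_shortfall pG pv).
have dZb := process_damped w (processZ beta (process_shortfall pG pv)).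
by rewrite -(ItgZ alpha_gt0 _ b t0 dZ) -(ItgD alpha_gt0 b t0 (process_damped w pf) dZb).
Qed.

Section comparison.
Variables (f G v1 v2 : R -> Omega -> R) (b1 b2 delta : R).
Hypotheses (pf : process f) (pG : process G) (pv1 : process v1) (pv2 : process v2).
Hypotheses (b1_gt0 : 0 < b1) (b12 : b1 <= b2).
Hypotheses (dyn1 : dynamics (penalized f G v1 b1) v1).
Hypotheses (dyn2 : dynamics (penalized f G v2 b2) v2).
Hypotheses (delta_gt0 : 0 < delta).
Hypothesis le_delta : forall r w, 0 <= r ->
  v1 r w - v2 r w <= delta * expR (- alpha * r).


(** Let [n] be the positive part of [v2 - v1]. The running payoffs differ by at most [b1 * n], while
    before [T] the difference [v1 - v2] at [u] is at most the discounted [delta] minus [n]: where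
    [n] is positive, [v1 - v2] equals [- n]. In the mean, the gain and the loss in [n] are those of
    [discounted_time]. *)
Lemma comparison_step (q : R) : discounted_time alpha b1 q ->
  \int[P]_w (Itg (penalized f G v1 b1 ^~ w) 0 (T w) + h w) -
  \int[P]_w (Itg (penalized f G v2 b2 ^~ w) 0 (T w) + h w) <= q * delta.
Proof.
move=> sel; have FT := filtrationT filF (lexx 0).
pose n := shortfall v2 v1.
have pn : process n by exact: (process_shortfall pv2 pv1).
have n0 r w : 0 <= n r w by exact: (shortfall_ge0 v2 v1 r w).
pose z r := \int[P]_(w in setT `&` [set w | (r%:E < T w)%E]) n r w.
have dz : damped alpha z.
  exact: (damped_killed_mean measurableT mT P pn n0).
have [u [u0 ub]] := sel z 0 delta (lexx _) dz delta_gt0.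
rewrite mulr0 expR0 mulr1 add0r in ub *; apply: le_trans.
have pg1 := process_penalized b1 pf pG pv1.
have pg2 := process_penalized b2 pf pG pv2.
have FuT := filtrationT filF u0.
rewrite (dynamics_upto pg1 pv1 dyn1 (lexx 0) u0 FuT).
rewrite (dynamics_upto pg2 pv2 dyn2 (lexx 0) u0 FuT).
have bI g b : process g -> bounded_measurable (fun w => Itg (g ^~ w) 0 (mine b (T w))).
  by move=> pg; exact: (process_Itg_bm alpha_gt0 (lexx 0) pg (mminT _)).
have bv v : process v ->
    bounded_measurable (fun w => if (u%:E < T w)%E then v u w else h w).
  by move=> pv; apply: bm_if => //; exact: (process_bm u0 pv).
have bn : bounded_measurable (killed setT T n u).
  exact: (process_bm u0 (process_killed measurableT mT pn)).
rewrite -bm_RintegralB//; [|by apply: bmD; [exact: bI|exact: bv]..].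
apply: (@le_trans _ _ (\int[P]_w ((b1 * Itg (n ^~ w) 0 (mine b1^-1%:E (T w)) -
    killed setT T n u w) + delta * expR (- alpha * u)))).
  apply: bm_le_Rintegral => //.
  - by apply: bmB; apply: bmD; [exact: bI|exact: bv|exact: bI|exact: bv].
  - apply: bmD; last exact: bm_cst.
    by apply: bmB => //; apply: bmZ; exact: bI.
  move=> w _.
  have dn := process_damped w pn.
  have d1 := process_damped w pg1; have d2 := process_damped w pg2.
  have l1 : Itg (penalized f G v1 b1 ^~ w) 0 (mine u%:E (T w)) -
      Itg (penalized f G v2 b2 ^~ w) 0 (mine u%:E (T w)) <=
      b1 * Itg (n ^~ w) 0 (mine b1^-1%:E (T w)).
    (* As [n] is nonnegative, the horizon may be enlarged from [u] to [1/b1], where it no longer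
       depends on [u]. *)
    apply: (@le_trans _ _ (b1 * Itg (n ^~ w) 0 (mine u%:E (T w)))); last first.
      rewrite ler_wpM2l ?(ltW b1_gt0)//; apply: (le_Itg_seg alpha_gt0) => //.
      by rewrite le_min !ge_min !lexx orbT lee_fin ltW.
    rewrite -(ItgB alpha_gt0 _ (lexx 0) d1 d2) -(ItgZ alpha_gt0 _ _ (lexx 0) dn).
    apply: (le_Itg alpha_gt0) => //.
    - exact: (process_damped w (processB pg1 pg2)).
    - exact: (process_damped w (processZ b1 pn)).
    move=> r r0; rewrite /penalized /n /shortfall.
    have /= m1 : b1 * Num.max (G r w - v2 r w) 0 <= b2 * Num.max (G r w - v2 r w) 0.
      by rewrite ler_wpM2r// le_max lexx orbT.
    have m2 : Num.max (G r w - v1 r w) 0 <=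
        Num.max (G r w - v2 r w) 0 + Num.max (v2 r w - v1 r w) 0.
      by case: (ltrP (G r w - v1 r w) 0) => ?; case: (ltrP (G r w - v2 r w) 0) => ?;
         case: (ltrP (v2 r w - v1 r w) 0) => ?; lra.
    have m3 := ler_wpM2l (ltW b1_gt0) m2.
    lra.
  have l2 : (if (u%:E < T w)%E then v1 u w else h w) -
      (if (u%:E < T w)%E then v2 u w else h w) <=
      delta * expR (- alpha * u) - killed setT T n u w.
    have led := le_delta w u0; have d0 := mulr_gt0 delta_gt0 (expR_gt0 (- alpha * u)).
    have kE : (w \in [set w | (u%:E < T w)%E]) = (u%:E < T w)%E.
      by apply/idP/idP; rewrite inE.
    rewrite /killed patchE setTI kE; case: ifP => uT.
      by rewrite /n /shortfall; case: (ltrP (v2 u w - v1 u w) 0) => ?; lra.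
    by rewrite subrr [leRHS]subr0 ltW.
  by rewrite opprD addrACA (le_trans (lerD l1 l2))// addrA addrAC.
rewrite bm_RintegralD//; [|by apply: bmB => //; apply: bmZ; exact: bI|exact: bm_cst].
rewrite bm_RintegralB//; last by apply: bmZ; exact: bI.
rewrite bm_RintegralZ//; last exact: bI.
rewrite (mean_Itg_min measurableT mT P alpha_gt0 _ (lexx 0) pn n0) lerD//; last first.
  apply: bm_Rintegral_le_cst => //; first exact: bm_cst.
  by rewrite mulr_ge0 ?expR_ge0// ltW.
by rewrite lerD2l lerN2 /z [leLHS]Rintegral_mkcond.
Qed.

End comparison.

End penalized_dynamics.

(** * Near-optimal stopping times *)

Section near_optimal_stopping.
Context (R : realType) (d : measure_display) (Omega : measurableType d).
Context (P : probability Omega R) (alpha : R) (F : R -> set (set Omega)).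
Context (T : Omega -> \bar R) (h : Omega -> R).
Hypotheses (alpha_gt0 : 0 < alpha) (filF : filtration F).
Hypotheses (stT : stopping_time F T) (bmh : bounded_measurable h).
Implicit Types (t u : R) (A B : set Omega) (tau : Omega -> \bar R).
Implicit Types (f g v G : R -> Omega -> R).
Local Notation process := (process alpha).

Let mT : measurable_fun setT T := stopping_time_measurable filF stT.

(** Discounting is already contained in [f], [G] and [h]. When [tau] and [T] coincide, the exit
    payoff [h] is paid, as in [J]. *)
Definition pay f G t tau w :=
  Itg (f ^~ w) t (mine (tau w) (T w)) +
  (if (tau w < T w)%E then G (fine (tau w)) w else h w).

Lemma bm_eval G tau : process G -> measurable_fun setT tau ->
  (forall w, 0 <= tau w)%E -> bounded_measurable (fun w => G (fine (tau w)) w).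
Proof.
move=> [mG [C GC]] mtau tau0; split.
  have mf : measurable_fun setT (fun w => fine (tau w) : measurableTypeR R).
    exact: (measurableT_comp (fine_measurable measurableT)).
  exact: (measurableT_comp mG (measurable_fun_pair mf (@measurable_id _ _ _))).
exists C => w; have t0 : 0 <= fine (tau w) by exact: fine_ge0.
have C0 : 0 <= C.
  by have := GC 0 w (lexx _); rewrite mulr0 expR0 mulr1; exact: le_trans.
rewrite (le_trans (GC _ w t0))// ler_piMr// -expR0 ler_expR.
by rewrite mulNr oppr_le0 mulr_ge0// ltW.
Qed.

Lemma bm_pay f G t tau : process f -> process G -> 0 <= t ->
  measurable_fun setT tau -> (forall w, 0 <= tau w)%E ->
  bounded_measurable (pay f G t tau).
Proof.
move=> pf pG t0 mtau tau0; apply: bmD.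
  by apply: (process_Itg_bm alpha_gt0 t0 pf); exact: measurable_mine.
by apply: bm_if => //; [exact: measurable_fun_lte|exact: bm_eval].
Qed.

Variables (f G v : R -> Omega -> R) (beta : R).
Hypotheses (pf : process f) (pG : process G) (pv : process v).
Hypothesis beta_gt0 : 0 < beta.
Hypothesis dyn : dynamics P F T h (penalized f G v beta) v.
Hypothesis adG : forall u, 0 <= u -> F u [set w | G u w < v u w].

Let bmin t (b : \bar R) g : 0 <= t -> process g ->
  bounded_measurable (fun w => Itg (g ^~ w) t (mine b (T w))).
Proof.
by move=> t0 pg; apply: (process_Itg_bm alpha_gt0 t0 pg); exact: measurable_mine.
Qed.

(* Letting the penalization act during [t, u] and then stopping at [u] if
   [G u >= v u] costs at most [beta * Itg z t (t + 1/beta) - z u]; the choice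
   of [u] turns this into a gain of a factor [q] on the error at [u]. *)
Lemma near_optimal_stopping_iter : exists2 q : R, 0 < q < 1 &
  exists C : R, forall n t A, 0 <= t -> F t A ->
  A `<=` [set w | (t%:E < T w)%E] -> exists tau,
  [/\ stopping_time F tau, forall w, (t%:E <= tau w)%E &
    \int[P]_(w in A) v t w <=
    \int[P]_(w in A) pay f G t tau w + C * q ^+ n * expR (- alpha * t)].
Proof.
have [q q01 sel] := exists_discounted_time alpha_gt0 beta_gt0.
exists q => //; have [q0 q1] := andP q01.
have [_ [C0 vGC]] := processB pv pG.
(* The added 1 makes the error bound positive, as [discounted_time] requires of [K]. *)
pose C := `|C0| + 1; have Cgt0 : 0 < C by rewrite ltr_wpDl.
exists C; elim=> [|n IH] t A t0 FA At.
  (* With no iteration left, one stops at once; the loss [v - G] is bounded by [C] times the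
     discount factor at [t]. *)
  exists (fun=> t%:E); split=> //; first exact: stopping_time_cst.
  have mA := filtration_measurable filF t0 FA.
  have bp : bounded_measurable (pay f G t (fun=> t%:E)).
    by apply: bm_pay => // w; rewrite lee_fin.
  rewrite -lerBlDl -bm_RintegralB//; last exact: process_bm pv.
  apply: bm_Rintegral_le_cst => //.
  - by apply: bmB => //; exact: (process_bm t0 pv).
  - by rewrite expr0 mulr1 mulr_ge0 ?expR_ge0// ltW.
  move=> w /At /= tT; rewrite /pay tT min_l ?(ltW tT)// Itg0// add0r expr0 mulr1.
  rewrite (le_trans (ler_norm _))// (le_trans (vGC t w t0))// ler_wpM2r ?expR_ge0//.
  by rewrite /C (le_trans (ler_norm _))// lerDl.
have mA := filtration_measurable filF t0 FA.
pose Z := shortfall G v.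
have pZ : process Z by exact: (process_shortfall pG pv).
have Z0 r w : 0 <= Z r w by exact: (shortfall_ge0 G v r w).
pose z r := \int[P]_(w in A `&` [set w | (r%:E < T w)%E]) Z r w.
have dz : damped alpha z by exact: (damped_killed_mean mA mT P pZ Z0).
have K0 : 0 < C * q ^+ n by rewrite mulr_gt0// exprn_gt0.
have [u [tu ub ineq]] := sel z t (C * q ^+ n) t0 dz K0.
have u0 : 0 <= u by exact: le_trans tu.
(* [B] is the event on which one continues after [u]; on the rest of [A] the payoff is [G u] before
   [T] and [h] from [T] on. *)
pose B := A `&` [set w | (u%:E < T w)%E] `&` [set w | G u w < v u w].
have FuA : F u A by exact: filtrationW FA.
have FB : F u B.
  apply: filtrationI => //; last exact: adG.
  by apply: filtrationI => //; exact: stopping_timeC.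
have mB := filtration_measurable filF u0 FB.
have [|tau [sttau utau IHtau]] := IH u B u0 FB; first by move=> w [[]].
exists (fun w => if w \in B then tau w else u%:E); split.
- exact: stopping_time_splice.
- move=> w; case: ifP => _; rewrite ?lee_fin//.
  by rewrite (le_trans _ (utau w))// lee_fin.
have mtau := stopping_time_measurable filF sttau.
have tau0 w : (0 <= tau w)%E by exact: sttau.1.
have mltu : measurable_fun setT (fun w => (u%:E < T w)%E) by exact: measurable_fun_lte.
have bpay : bounded_measurable (pay f G u tau) by exact: bm_pay.
have bvu := process_bm u0 pv; have bGu := process_bm u0 pG.
pose stop w := if (u%:E < T w)%E then G u w else h w.
have bstop : bounded_measurable stop by exact: bm_if.
have minB : measurable_fun setT (fun w => w \in B).
  by apply: measurable_fun_bool => //; rewrite setTI (_ : _ @^-1` _ = B)//;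
     apply/seteqP; split => w /=; [exact: set_mem|exact: mem_set].
pose psi (k : Omega -> R) w := if w \in B then k w else stop w.
have bpsi k : bounded_measurable k -> bounded_measurable (psi k).
  by move=> bk; exact: bm_if.
have pg := process_penalized beta pf pG pv.
rewrite (dyn t0 FA At) (dynamics_upto alpha_gt0 filF stT bmh pg pv dyn t0 tu FuA).
(* The penalty is enlarged to the full window. At [u < T], [v] equals the larger of [v] and [G],
   which [psi (v u)] selects, minus the shortfall [Z]; this [- Z] compensates the penalty in the
   mean. *)
apply: (@le_trans _ _ (\int[P]_(w in A) ((Itg (f ^~ w) t (mine u%:E (T w)) +
    beta * Itg (Z ^~ w) t (mine (t + beta^-1)%:E (T w))) +
    (psi (v u) w - killed A T Z u w)))).
  apply: bm_le_Rintegral => //.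
  - by apply: bmD; [exact: bmin|exact: bm_if].
  - apply: bmD; first by apply: bmD; [exact: bmin|apply: bmZ; exact: bmin].
    apply: bmB; first exact: bpsi.
    exact: (process_bm u0 (process_killed mA mT pZ)).
  move=> w Aw; apply: lerD.
    rewrite (Itg_penalized alpha_gt0)// lerD2l ler_wpM2l ?(ltW beta_gt0)//.
    apply: (le_Itg_seg alpha_gt0) => //; first exact: process_damped pZ.
    by rewrite le_min !ge_min lexx orbT lee_fin ltW.
  have kE : (w \in A `&` [set w | (u%:E < T w)%E]) = (u%:E < T w)%E.
    by apply/idP/idP; rewrite inE => // -[].
  rewrite /killed patchE kE /psi /stop; case: ifP => uT.
    have -> : (w \in B) = (G u w < v u w).
      by apply/idP/idP; rewrite inE => // -[].
    rewrite /Z /shortfall; case: (ltP (G u w) (v u w)) => Gv.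
      by rewrite max_r ?subr0// subr_le0 ltW.
    by rewrite max_l ?subr_ge0//; lra.
  rewrite ifF ?subr0//; apply/negP; rewrite inE => -[[_]] /=.
  by rewrite uT.
have bf := bmin u%:E t0 pf; have bZ := bmin (t + beta^-1)%:E t0 pZ.
have bk := process_bm u0 (process_killed mA mT pZ).
have mltB k : bounded_measurable k -> \int[P]_(w in A) psi k w =
    \int[P]_(w in B) k w + \int[P]_(w in A `\` B) stop w.
  move=> bmk; rewrite (bm_RintegralI P mA mB); last exact: bpsi.
  rewrite (_ : A `&` B = B); last by apply/setIidPr => w [[]].
  congr (_ + _); apply: eq_Rintegral => w.
    by rewrite /psi => ->.
  by rewrite inE => -[_ Bw]; rewrite /psi ifF//; apply/negP; rewrite inE.
rewrite bm_RintegralD//; [|by apply: bmD => //; exact: bmZ|by apply: bmB => //; exact: bpsi].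
rewrite bm_RintegralD//; last exact: bmZ.
rewrite bm_RintegralZ// bm_RintegralB//; last exact: bpsi.
rewrite (mltB _ bvu) (mean_Itg_min mA mT P alpha_gt0 _ t0 pZ Z0).
have -> : \int[P]_(w in A) killed A T Z u w = z u.
  by rewrite /killed -Rintegral_mkcondr setIA setIid.
rewrite [X in _ <= X + _](_ : _ = \int[P]_(w in A)
   (Itg (f ^~ w) t (mine u%:E (T w)) + psi (pay f G u tau) w)); last first.
  apply: eq_Rintegral => w _; rewrite /psi /pay /stop; case: ifP => wB.
    have := set_mem wB => -[[_ /= uT] _].
    rewrite (Itg_split alpha_gt0 t0 (process_damped w pf) tu) ?le_min ?utau ?(ltW uT)//.
    by rewrite (min_l (ltW uT)) addrA.
  by [].
rewrite bm_RintegralD//; last exact: bpsi.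
rewrite (mltB _ bpay) exprS mulrA [C * q]mulrC; lra.
Qed.

Lemma near_optimal_stopping (e : R) : 0 < e -> exists2 tau,
  stopping_time F tau & \int[P]_w (Itg (penalized f G v beta ^~ w) 0 (T w) + h w) <=
  \int[P]_w pay f G 0 tau w + e.
Proof.
move=> e0; have [q /andP[q0 q1] [C iter]] := near_optimal_stopping_iter.
have [n Cqn] : exists n, C * q ^+ n <= e.
  have q1' : `|q| < 1 by rewrite ger0_norm ?ltW.
  have : (fun n => C * q ^+ n) @ \oo --> C * 0.
    by apply: cvgM; [exact: cvg_cst|exact: cvg_expr].
  rewrite mulr0 => /cvgrPdist_le /(_ e e0)[n _ /(_ n)].
  rewrite /= leqnn sub0r normrN => /(_ isT) le; exists n.
  exact: le_trans (ler_norm _) le.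
have F0 := stopping_timeC filF stT (lexx 0).
have mF0 := filtration_measurable filF (lexx 0) F0.
have [//|tau [st tau0 le]] := iter n 0 _ (lexx 0) F0.
exists tau => //.
have mtau := stopping_time_measurable filF st.
have bp : bounded_measurable (pay f G 0 tau) by exact: bm_pay.
have pg := process_penalized beta pf pG pv.
have bg : bounded_measurable (fun w => Itg (penalized f G v beta ^~ w) 0 (T w) + h w).
  by apply: bmD => //; exact: (process_Itg_bm alpha_gt0 (lexx 0) pg mT).
rewrite (bm_RintegralI P measurableT mF0 bg) (bm_RintegralI P measurableT mF0 bp).
rewrite setTI -(dyn (lexx 0) F0 (@subset_refl _ _)).
(* Where [T] is 0, nothing is collected before the exit and both payoffs reduce to [h]. *)
have -> : \int[P]_(w in setT `\` [set w | (0%:E < T w)%E])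
      (Itg (penalized f G v beta ^~ w) 0 (T w) + h w) =
    \int[P]_(w in setT `\` [set w | (0%:E < T w)%E]) pay f G 0 tau w.
  apply: eq_Rintegral => w; rewrite inE => -[_ /negP]; rewrite -leNgt => T0.
  rewrite /pay Itg0// Itg0 ?ge_min ?T0 ?orbT// ifF//.
  by apply/negbTE; rewrite -leNgt (le_trans T0).
by rewrite mulr0 expR0 mulr1 in le; lra.
Qed.

End near_optimal_stopping.

(** * Stopping is dominated by penalization *)

Section stopping_dominated_by_penalization.
Context (R : realType) (d : measure_display) (Omega : measurableType d).
Context (P : probability Omega R) (alpha : R) (F : R -> set (set Omega)).
Context (T : Omega -> \bar R) (h : Omega -> R).
Hypotheses (alpha_gt0 : 0 < alpha) (filF : filtration F).
Hypotheses (stT : stopping_time F T) (bmh : bounded_measurable h).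
Implicit Types (t u : R) (A B : set Omega) (tau : Omega -> \bar R).
Local Notation process := (process alpha).

Let mT : measurable_fun setT T := stopping_time_measurable filF stT.

Variables (f G : R -> Omega -> R).
Hypotheses (pf : process f) (pG : process G).

Let bpay tau : stopping_time F tau -> bounded_measurable (pay T h f G 0 tau).
Proof.
move=> st; apply: (bm_pay alpha_gt0 filF stT bmh) => //; last exact: st.1.
exact: stopping_time_measurable st.
Qed.

Section fixed_penalization.
Variables (v : R -> Omega -> R) (beta : R).
Hypotheses (pv : process v) (beta_gt0 : 0 < beta).
Hypothesis dyn : dynamics P F T h (penalized f G v beta) v.

Local Notation Psi := (fun w => Itg (penalized f G v beta ^~ w) 0 (T w) + h w).
Local Notation Z := (shortfall G v).
Local Notation zeta r :=
  (\int[P]_(w in setT `&` [set w | (r%:E < T w)%E]) Z r w).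

Let pg : process (penalized f G v beta).
Proof. exact: process_penalized. Qed.

Let pZ : process Z. Proof. exact: process_shortfall. Qed.

Let bPsi : bounded_measurable Psi.
Proof. by apply: bmD => //; exact: (process_Itg_bm alpha_gt0 (lexx 0) pg mT). Qed.

(** The penalty is nonnegative and [G] is at most [v] plus the shortfall, so stopping at [u] beats
    the penalized payoff by at most the mean shortfall at [u]. That mean is taken over all paths
    alive at [u], hence bounds the error for every [A]. *)
Lemma pay_cst_le u A : 0 <= u -> F u A ->
  \int[P]_(w in A) pay T h f G 0 (fun=> u%:E) w <= \int[P]_(w in A) Psi w + zeta u.
Proof.
move=> u0 FA; have mA := filtration_measurable filF u0 FA.
have bk := process_bm u0 (process_killed measurableT mT pZ).
have bE : bounded_measurable (fun w =>
    Itg (penalized f G v beta ^~ w) 0 (mine u%:E (T w)) +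
    (if (u%:E < T w)%E then v u w else h w)).
  apply: bmD.
    by apply: (process_Itg_bm alpha_gt0 (lexx 0) pg); exact: measurable_mine.
  by apply: bm_if => //; [exact: measurable_fun_lte|exact: (process_bm u0 pv)].
rewrite (dynamics_upto alpha_gt0 filF stT bmh pg pv dyn (lexx 0) u0 FA).
apply: (@le_trans _ _ (\int[P]_(w in A)
  ((Itg (penalized f G v beta ^~ w) 0 (mine u%:E (T w)) +
    (if (u%:E < T w)%E then v u w else h w)) + killed setT T Z u w))).
  apply: bm_le_Rintegral => //.
  - exact: (bpay (stopping_time_cst filF u0)).
  - exact: bmD.
  move=> w Aw; rewrite /pay -addrA lerD//.
    apply: (le_Itg alpha_gt0) => //; [exact: process_damped pf|exact: process_damped pg|].
    by move=> r r0; rewrite lerDl mulr_ge0 ?(ltW beta_gt0)// shortfall_ge0.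
  rewrite /killed patchE setTI.
  have -> : (w \in [set w | (u%:E < T w)%E]) = (u%:E < T w)%E.
    by apply/idP/idP; rewrite inE.
  by case: ifP => uT; [exact: shortfallP|rewrite addr0].
have zetaE : zeta u = \int[P]_w killed setT T Z u w by exact: Rintegral_mkcond.
rewrite bm_RintegralD// lerD2l zetaE (bm_RintegralI P measurableT mA bk).
rewrite [in leRHS]setTI lerDl; apply: Rintegral_ge0 => w _.
by rewrite /killed patchE; case: ifP => // _; exact: shortfall_ge0.
Qed.

(** [tau] is rounded up to a chosen time of the next cell, and [pay_cst_le] is applied once per
    cell: the cells 0 to [N] give the factor [N.+1]. Beyond the grid [sigma] never stops, so the
    construction remains finite. *)
Lemma pay_grid_le tau (delta eta : R) : stopping_time F tau -> 0 < delta ->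
  (forall j : nat, exists u, [/\ j%:R * delta <= u, u < j.+1%:R * delta & zeta u <= eta]) ->
  forall N : nat, exists sigma, [/\ stopping_time F sigma,
    forall w, (tau w <= (N%:R * delta)%:E)%E ->
      (tau w <= sigma w)%E /\ (sigma w <= tau w + (2 * delta)%:E)%E,
    forall w, ~ (tau w <= (N%:R * delta)%:E)%E -> sigma w = +oo%E &
    \int[P]_w pay T h f G 0 sigma w <= \int[P]_w Psi w + N.+1%:R * eta].
Proof.
move=> st delta0 grid.
pose E j := [set w | (tau w <= (j%:R * delta)%:E)%E].
have jd0 j : 0 <= j%:R * delta :> R by rewrite mulr_ge0// ltW.
have FE j : F (j%:R * delta) (E j) by exact: st.2.
have mE j : measurable (E j) by exact: filtration_measurable (FE j).
(* Never stopping yields the payoff without penalty, which is pathwise at most the penalized one. *)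
have Einfty sigma j : (forall w, ~ E j w -> sigma w = +oo%E) ->
    stopping_time F sigma ->
    \int[P]_(w in ~` E j) pay T h f G 0 sigma w <= \int[P]_(w in ~` E j) Psi w.
  move=> sy sts; apply: bm_le_Rintegral => //; first exact: measurableC.
    exact: bpay.
  move=> w /sy sw; rewrite /pay sw (min_r (leey _)) ltNge leey/= lerD2r.
  apply: (le_Itg alpha_gt0) => //; [exact: process_damped pf|exact: process_damped pg|].
  by move=> r r0; rewrite lerDl mulr_ge0 ?(ltW beta_gt0)// shortfall_ge0.
suff main N : exists sigma, [/\ stopping_time F sigma,
    forall w, E N w ->
      (tau w <= sigma w)%E /\ (sigma w <= tau w + (2 * delta)%:E)%E,
    forall w, ~ E N w -> sigma w = +oo%E &
    \int[P]_(w in E N) pay T h f G 0 sigma w <=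
    \int[P]_(w in E N) Psi w + N.+1%:R * eta].
  move=> N; have [sigma [sts sE sy le]] := main N; exists sigma; split => //.
  rewrite (bm_RintegralI P measurableT (mE N) (bpay sts)).
  rewrite (bm_RintegralI P measurableT (mE N) bPsi) !setTI setTD.
  by have := Einfty sigma N sy sts; lra.
pose splice sigma j (u : R) w :=
  if w \in E j then sigma w else if w \in E j.+1 then u%:E else +oo%E : \bar R.
elim: N => [|N [sigma [sts sE sy le]]].
  have [u []] := grid 0%N; rewrite mul0r mul1r => u0 ud zu.
  exists (fun w => if w \in E 0%N then u%:E else +oo%E).
  have stu : stopping_time F (fun w => if w \in E 0%N then u%:E else +oo%E).
    split => [w|t t0]; first by case: ifP; rewrite ?lee_fin// leey.
    have [ut|tu] := leP u t.
      have := filtrationW filF (jd0 0%N) _ (FE 0%N); rewrite mul0r => /(_ t t0).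
      congr F; apply/seteqP; split => w /=.
        by move=> Ew; rewrite mem_set//= lee_fin.
      by case: ifP => [/set_mem//|_]; rewrite leye_eq.
    rewrite (_ : [set w | _] = set0); first exact: filtration0.
    apply/seteqP; split => // w /=; case: ifP => _; last by rewrite leye_eq.
    by rewrite lee_fin leNgt tu.
  split => //.
  - move=> w Ew; rewrite mem_set//; have := Ew; rewrite /E/= mul0r => tw0.
    have -> : tau w = 0%E by apply: le_anti; rewrite tw0 st.1.
    by rewrite add0e !lee_fin; split => //; lra.
  - by move=> w Ew; rewrite ifF//; apply/negP => /set_mem.
  - rewrite mul1r (le_trans _ (lerD (lexx _) zu))//.
    have FuE : F u (E 0%N) by have := FE 0%N; rewrite mul0r; exact: filtrationW.
    rewrite (le_trans _ (pay_cst_le u0 FuE))// le_eqVlt; apply/orP; left; apply/eqP.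
    by apply: eq_Rintegral => w wE; rewrite /pay wE.
(* Paths with [tau] in the interval from [N * delta] to [N.+1 * delta] stop in the following cell:
   only there is the event known at time [u]. This is why [sigma] may lag behind [tau] by up to two
   meshes. *)
have [u [uN uN1 zu]] := grid N.+1.
have u0 : 0 <= u by exact: le_trans uN.
have Nd : N%:R * delta <= N.+1%:R * delta by rewrite ler_wpM2r ?ler_nat// ltW.
have EN w : E N w -> E N.+1 w.
  by move=> /le_trans; apply; rewrite lee_fin.
have sts' : stopping_time F (splice sigma N u).
  split => [w|t t0].
    by rewrite /splice; case: ifP => _; [exact: sts.1|case: ifP => _; rewrite ?lee_fin ?leey].
  have [ut|tu] := leP u t.
    rewrite (_ : [set w | _] = [set w | (sigma w <= t%:E)%E] `|` (E N.+1 `\` E N)).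
      apply: filtrationU => //; first exact: sts.2.
      rewrite setDE; apply: filtrationI => //; last apply: filtrationC => //.
        by apply: filtrationW (FE N.+1) => //; exact: le_trans ut.
      by apply: filtrationW (FE N) => //; exact: le_trans (le_trans uN ut).
    apply/seteqP; split => w /=; rewrite /splice.
      case: ifPn => [_|/negP wN]; first by left.
      case: ifPn => [/set_mem wN1 _|_]; last by rewrite leye_eq.
      by right; split => // /mem_set.
    have [wN|wN] := pselect (E N w).
      by rewrite mem_set// => -[|[]].
    rewrite (sy _ wN) leye_eq => -[//|[wN1 _]].
    by rewrite memNset// mem_set// lee_fin.
  rewrite (_ : [set w | _] = [set w | (sigma w <= t%:E)%E]); first exact: sts.2.
  apply/seteqP; split => w /=; rewrite /splice.
    case: ifPn => // _; case: ifPn => _; last by rewrite leye_eq.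
    by rewrite lee_fin leNgt tu.
  have [wN|wN] := pselect (E N w); first by rewrite mem_set.
  by rewrite (sy _ wN) leye_eq.
exists (splice sigma N u); split => //.
- move=> w wN1; rewrite /splice; case: ifPn => [/set_mem /sE//|/negP wN].
  rewrite mem_set//; split; first by rewrite (le_trans wN1)// lee_fin.
  have : ((N%:R * delta)%:E < tau w)%E.
    by rewrite ltNge; apply/negP => h'; apply: wN; exact: mem_set.
  case: (tau w) => [r| |]//; last by rewrite leey.
  rewrite lte_fin -EFinD lee_fin => Nr; move: uN1; rewrite -!natr1; lra.
- by move=> w wN1; rewrite /splice !memNset// => /EN.
rewrite (bm_RintegralI P (mE N.+1) (mE N) (bpay sts')).
rewrite (bm_RintegralI P (mE N.+1) (mE N) bPsi).
have -> : E N.+1 `&` E N = E N by apply/setIidPr.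
have -> : \int[P]_(w in E N) pay T h f G 0 (splice sigma N u) w =
    \int[P]_(w in E N) pay T h f G 0 sigma w.
  by apply: eq_Rintegral => w wN; rewrite /pay /splice wN.
have FD : F u (E N.+1 `\` E N).
  rewrite setDE; apply: filtrationI => //; last apply: filtrationC => //.
    exact: filtrationW (FE N.+1).
  by apply: filtrationW (FE N) => //; exact: le_trans uN.
have -> : \int[P]_(w in E N.+1 `\` E N) pay T h f G 0 (splice sigma N u) w =
    \int[P]_(w in E N.+1 `\` E N) pay T h f G 0 (fun=> u%:E) w.
  apply: eq_Rintegral => w; rewrite inE => -[wN1 wN].
  by rewrite /pay /splice memNset// mem_set.
have := pay_cst_le u0 FD; rewrite -[N.+2%:R]natr1 mulrDl mul1r.
lra.
Qed.

(** The two means differ by [beta] times the integral of the mean shortfall over the half-line, so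
    its average over [t, u) is at most this difference over [beta * (u - t)]. The added 1 makes the
    comparison with the average strict. *)
Lemma exists_small_shortfall t u : 0 <= t -> t < u ->
  exists r, [/\ t <= r, r < u & zeta r <=
    (\int[P]_w Psi w - \int[P]_w (Itg (f ^~ w) 0 (T w) + h w) + 1) /
    (beta * (u - t))].
Proof.
move=> t0 tu; set D := \int[P]_w Psi w - _.
have ut0 : 0 < u - t by rewrite subr_gt0.
have Z0 r w : 0 <= Z r w by exact: shortfall_ge0.
have dz := damped_killed_mean measurableT mT P pZ Z0.
have bI g : process g -> bounded_measurable (fun w => Itg (g ^~ w) 0 (T w)).
  by move=> pg'; exact: (process_Itg_bm alpha_gt0 (lexx 0) pg' mT).
have DE : D = beta * Itg (fun r => zeta r) 0 +oo%E.
  rewrite /D -bm_RintegralB//; last by apply: bmD => //; exact: bI.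
  rewrite -(mean_Itg_min measurableT mT P alpha_gt0 _ (lexx 0) pZ Z0).
  rewrite -bm_RintegralZ//; last first.
    by apply: (process_Itg_bm alpha_gt0 (lexx 0) pZ); exact: measurable_mine.
  apply: eq_Rintegral => w _; rewrite (Itg_penalized alpha_gt0)//.
  by rewrite (min_r (leey _)); ring.
have iz := damped_integrable alpha_gt0 u%:E t0 dz.
have [|r [tr ru zr]] := @exists_lt_mean _ (fun r => zeta r) t u
    ((D + 1) / (beta * (u - t))) tu iz.
  rewrite invfM mulrA mulfVK ?gt_eqF// ltr_pdivlMr//.
  apply: (@le_lt_trans _ _ D); last by rewrite ltrDl.
  rewrite DE mulrC ler_wpM2l ?(ltW beta_gt0)//.
  apply: (le_Itg_seg alpha_gt0) => //; last exact: leey.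
  by move=> r _; apply: Rintegral_ge0.
by exists r; split => //; exact: ltW.
Qed.

End fixed_penalization.

Lemma pay_bounded : exists C : R, forall tau, (forall w, 0 <= tau w)%E ->
  forall w, `|pay T h f G 0 tau w| <= C.
Proof.
have [K _ KP] := Itg_bound alpha_gt0.
have [mf [Cf fC]] := pf; have [mG [CG GC]] := pG; have [_ [Ch hC]] := bmh.
exists (Cf * K + Num.max CG Ch) => tau tau0 w.
rewrite /pay (le_trans (ler_normD _ _))// lerD//.
  apply: KP => //; first exact: jointly_measurable_section1.
  by move=> r; exact: fC.
case: ifP => _; rewrite le_max ?hC ?orbT//; apply/orP; left.
have t0 : 0 <= fine (tau w) by exact: fine_ge0.
rewrite (le_trans (GC _ w t0))// ler_piMr//.
  by have := GC 0 w (lexx _); rewrite mulr0 expR0 mulr1; exact: le_trans.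
by rewrite -expR0 ler_expR mulNr oppr_le0 mulr_ge0// ltW.
Qed.

Lemma cvg_mean_pay (sigma : nat -> Omega -> \bar R) tau :
  (forall k, stopping_time F (sigma k)) -> stopping_time F tau ->
  (forall w, pay T h f G 0 (sigma k) w @[k --> \oo] --> pay T h f G 0 tau w) ->
  \int[P]_w pay T h f G 0 (sigma k) w @[k --> \oo] --> \int[P]_w pay T h f G 0 tau w.
Proof.
move=> sts st cv; have [C payC] := pay_bounded.
have mp s : stopping_time F s -> measurable_fun setT (EFin \o pay T h f G 0 s).
  by move=> ss; apply/measurable_EFinP; exact: (bpay ss).1.
have iC : P.-integrable setT (EFin \o (fun=> C)).
  by apply: bm_integrable => //; exact: bm_cst.
have [] := @dominated_convergence _ _ _ P setT measurableT
  (fun k => EFin \o pay T h f G 0 (sigma k)) (EFin \o pay T h f G 0 tau)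
  (EFin \o (fun=> C)).
- by move=> k; exact: mp.
- exact: mp.
- by apply: aeW => w _; apply: cvg_EFin; [exact: nearW|exact: cv].
- exact: iC.
- by apply: aeW => w k _ /=; rewrite lee_fin payC//; exact: (sts k).1.
move=> _ _ cvI; apply: fine_cvg.
rewrite fineK; first exact: cvI.
by apply: integrable_fin_num => //; exact: bm_integrable (bpay st).
Qed.

(** Approximation from the right respects the strict test against [T]: if [tau < T], then eventually
    [sigma k < T], and if [T <= tau], the payoff does not change at all. An infinite [tau] forces
    every [sigma k] to be infinite. *)
Lemma cvg_pay_right (sigma : nat -> Omega -> \bar R) tau w :
  (forall t, 0 <= t -> G r w @[r --> t^'+] --> G t w) -> (0 <= tau w)%E ->
  (forall k, ((tau w <= (k.+1%:R)%:E)%E ->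
      (tau w <= sigma k w)%E /\ (sigma k w <= tau w + (2 / k.+1%:R)%:E)%E) /\
    (~ (tau w <= (k.+1%:R)%:E)%E -> sigma k w = +oo%E)) ->
  pay T h f G 0 (sigma k) w @[k --> \oo] --> pay T h f G 0 tau w.
Proof.
move=> Grc; rewrite /pay; case: (tau w) => [t| |]//; last first.
  move=> _ sk; rewrite (_ : (fun k => _) = fun=>
    Itg (f ^~ w) 0 (mine +oo%E (T w)) +
    (if (+oo < T w)%E then G (fine +oo%E) w else h w)); first exact: cvg_cst.
  by apply/funext => k; rewrite (sk k).2// leye_eq.
rewrite lee_fin => t0 sk.
have [C fC] : exists C, forall r, 0 <= r -> `|f r w| <= C.
  have [_ [C fC]] := pf; exists C => r r0; rewrite (le_trans (fC r w r0))// ler_piMr//.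
    by have := fC 0 w (lexx _); rewrite mulr0 expR0 mulr1; exact: le_trans.
  by rewrite -expR0 ler_expR mulNr oppr_le0 mulr_ge0// ltW.
have C0 : 0 <= C by exact: le_trans (normr_ge0 _) (fC 0 (lexx _)).
have sk' : \forall k \near \oo, exists s, [/\ sigma k w = s%:E, t <= s & s <= t + 2 / k.+1%:R].
  near=> k; have tk : (t%:E <= k.+1%:R%:E)%E.
    rewrite lee_fin (@le_trans _ _ k%:R) ?ler_nat//; near: k; exact: nbhs_infty_ger.
  have [] := (sk k).1 tk; case: (sigma k w) => [s| |]; [|by move=> _; rewrite leye_eq|by rewrite leeNy_eq].
  by rewrite !lee_fin => ts st; exists s.
apply/cvgrPdist_le => e e0.
have [Tt|tT] := leP (T w) t%:E.
  near=> k; have [s [-> ts _]] : exists s, [/\ sigma k w = s%:E, t <= s & s <= t + 2 / k.+1%:R].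
    by near: k.
  have Ts : (T w <= s%:E)%E by rewrite (le_trans Tt)// lee_fin.
  by rewrite (min_r Ts) (le_gtF Ts) subrr normr0 ltW.
have [d0 d00 dT] : exists2 d0 : R, 0 < d0 & forall s, s < t + d0 -> (s%:E < T w)%E.
  case: (T w) tT => [r| |]//.
    rewrite lte_fin => tr; exists (r - t); first by rewrite subr_gt0.
    by move=> s; rewrite addrC subrK lte_fin.
  by move=> _; exists 1 => // s _; rewrite ltry.
have e20 : 0 < e / 2 by rewrite divr_gt0.
have [d1 /= d10 Gd] : exists2 d1 : R, 0 < d1 & forall s, t <= s -> s < t + d1 ->
    `|G t w - G s w| <= e / 2.
  move: (Grc t t0) => /cvgrPdist_le /(_ _ e20).
  rewrite near_withinE => /nbhs_ballP[d1 /= d10 H]; exists d1 => // s ts std.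
  have [->|st] := eqVneq s t; first by rewrite subrr normr0 ltW.
  apply: H; last by rewrite lt_neqAle eq_sym st.
  by rewrite /ball/= distrC ger0_norm ?subr_ge0// ltrBlDl.
have d20 : 0 < e / 2 / (C + 1) by rewrite divr_gt0// ltr_wpDl.
(* [d0] keeps the approximation before [T], [d1] controls [G], and the last term controls the extra
   running payoff; [C + 1] avoids a division by zero. *)
pose dd := Num.min (Num.min d0 d1) (e / 2 / (C + 1)).
have dd0 : 0 < dd by rewrite !lt_min d00 d10.
have dd20 : 0 < dd / 2 by rewrite divr_gt0.
have [dd_0 dd_1 dd_2] : [/\ dd <= d0, dd <= d1 & dd <= e / 2 / (C + 1)].
  by rewrite /dd !ge_min !lexx !orbT.
near=> k; have [s [-> ts sle]] : exists s, [/\ sigma k w = s%:E, t <= s & s <= t + 2 / k.+1%:R].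
  by near: k.
have sdd : s < t + dd.
  rewrite (le_lt_trans sle)// ltrD2l.
  have : k.+1%:R^-1 < dd / 2.
    by near: k; exact: near_infty_natSinv_lt (PosNum dd20).
  by rewrite ltr_pdivlMr// [X in X < _]mulrC.
have sT : (s%:E < T w)%E by apply: dT; rewrite (lt_le_trans sdd)// lerD2l.
rewrite sT (min_l (ltW sT)) /=.
rewrite (Itg_split alpha_gt0 (lexx 0) (process_damped w pf) t0 (_ : (t%:E <= s%:E)%E)) ?lee_fin//.
rewrite (_ : _ - _ = - Itg (f ^~ w) t s%:E + (G t w - G s w)); last by ring.
rewrite (le_trans (ler_normD _ _))// normrN [leRHS](splitr e) lerD//; last first.
  by apply: Gd => //; rewrite (lt_le_trans sdd)// lerD2l.
rewrite (le_trans (Itg_fin_ler alpha_gt0 t0 ts (process_damped w pf) fC))//.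
have : (C + 1) * (s - t) <= e / 2.
  by rewrite mulrC -ler_pdivlMr ?ltr_wpDl// (le_trans _ dd_2)// lerBlDl ltW.
by apply: le_trans; rewrite ler_wpM2r ?subr_ge0// lerDl.
Unshelve. all: by end_near. Qed.

(* [tau] is approximated from the right by stopping times with values in
   finite sets of times at which the shortfall of the penalized value is small
   in mean. *)
Lemma mean_pay_le (vb : R -> R -> Omega -> R) (L : R) tau :
  (forall beta, 0 < beta -> process (vb beta)) ->
  (forall beta, 0 < beta ->
     dynamics P F T h (penalized f G (vb beta) beta) (vb beta)) ->
  (forall beta, 0 < beta ->
     \int[P]_w (Itg (penalized f G (vb beta) beta ^~ w) 0 (T w) + h w) <= L) ->
  (forall w t, 0 <= t -> G r w @[r --> t^'+] --> G t w) ->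
  stopping_time F tau -> \int[P]_w pay T h f G 0 tau w <= L.
Proof.
move=> pvb dynb leL Grc st.
(* Since [L] bounds all penalized means, [C] exceeds the mean total penalty by at least 1, uniformly
   in [beta]. *)
pose C := L - \int[P]_w (Itg (f ^~ w) 0 (T w) + h w) + 1.
have bI g : process g -> bounded_measurable (fun w => Itg (g ^~ w) 0 (T w)).
  by move=> pg'; exact: (process_Itg_bm alpha_gt0 (lexx 0) pg' mT).
have C0 : 0 < C.
  have p1 : 0 < (1 : R) by [].
  rewrite /C ltr_wpDl// subr_ge0; apply: le_trans (leL _ p1).
  apply: bm_le_Rintegral => //; [by apply: bmD => //; exact: bI| |].
    by apply: bmD => //; apply: bI; exact: process_penalized (pvb _ p1).
  move=> w _; rewrite lerD2r; apply: (le_Itg alpha_gt0) => //.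
  - exact: process_damped pf.
  - by apply: (process_damped w); exact: process_penalized (pvb _ p1).
  - by move=> r r0; rewrite lerDl mul1r shortfall_ge0.
have : forall k : nat, exists sigma, [/\ stopping_time F sigma,
    forall w, (tau w <= (k.+1%:R)%:E)%E ->
      (tau w <= sigma w)%E /\ (sigma w <= tau w + (2 / k.+1%:R)%:E)%E,
    forall w, ~ (tau w <= (k.+1%:R)%:E)%E -> sigma w = +oo%E &
    \int[P]_w pay T h f G 0 sigma w <= L + k.+1%:R^-1].
  (* With mesh [1/(k+1)], taking [(k+1)^2] cells puts the horizon of the grid at [k+1]: the mesh
     vanishes while the horizon grows to infinity. *)
  move=> k; pose delta : R := k.+1%:R^-1; pose N := (k.+1 * k.+1)%N.
  have delta0 : 0 < delta by rewrite invr_gt0.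
  (* Solves [N.+1 * (C / (beta * delta)) = delta]: the errors of all cells then add up to one
     mesh. *)
  pose beta := N.+1%:R * C / delta ^+ 2.
  have beta0 : 0 < beta by rewrite !mulr_gt0// invr_gt0 exprn_gt0.
  have Nd : N%:R * delta = k.+1%:R by rewrite /N /delta natrM mulfK.
  have := @pay_grid_le _ _ (pvb _ beta0) beta0 (dynb _ beta0) tau delta
    (C / (beta * delta)) st delta0.
  move=> /(_ _ N) []; last first.
    rewrite Nd => sigma [s1 s2 s3 s4]; exists sigma; split => //.
    rewrite (le_trans s4)// lerD ?leL// -/delta.
    rewrite le_eqVlt; apply/orP; left; apply/eqP; rewrite /beta.
    by field; rewrite !gt_eqF//= pnatr_eq0.
  move=> j; have jd0 : 0 <= j%:R * delta by rewrite mulr_ge0// ltW.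
  have jd : j%:R * delta < j.+1%:R * delta by rewrite ltr_pM2r// ltr_nat.
  have [r [r1 r2 r3]] := exists_small_shortfall (pvb _ beta0) beta0 jd0 jd.
  exists r; split => //; rewrite (le_trans r3)//.
  have bd0 : 0 <= (beta * delta)^-1 by rewrite invr_ge0 ltW// mulr_gt0.
  rewrite -mulrBl -natrB// subSnn mul1r ler_wpM2r//.
  by rewrite /C lerD2r lerD2r; exact: leL.
move=> /choice[sigma sigmaP].
have cvL : L + k.+1%:R^-1 @[k --> \oo] --> L.
  rewrite -[X in _ --> X]addr0; apply: cvgD; first exact: cvg_cst.
  exact: cvg_harmonic.
have cvp : \int[P]_w pay T h f G 0 (sigma k) w @[k --> \oo] -->
    \int[P]_w pay T h f G 0 tau w.
  apply: cvg_mean_pay => //; first by move=> k; have [] := sigmaP k.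
  move=> w; apply: cvg_pay_right; [exact: Grc|exact: st.1|].
  by move=> k; have [_ s2 s3 _] := sigmaP k; split; [exact: s2|exact: s3].
apply: (ler_cvg_to cvp cvL); apply: nearW => k.
by have [] := sigmaP k.
Qed.

End stopping_dominated_by_penalization.

(** * Right-continuous paths in a metric space *)

Lemma measurable_select (d d' : measure_display) (S : measurableType d)
  (S' : measurableType d') (N : S -> nat) (g : nat -> S -> S') :
  (forall k, measurable [set s | N s = k]) ->
  (forall k, measurable_fun setT (g k)) ->
  measurable_fun setT (fun s => g (N s) s).
Proof.
move=> mN mg _ B mB; rewrite setTI.
rewrite (_ : _ @^-1` B = \bigcup_k ([set s | N s = k] `&` g k @^-1` B)).
  apply: bigcupT_measurable => k; apply: measurableI => //.
  by rewrite -[X in measurable X]setTI; exact: mg.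
apply/seteqP; split => [s /= Bs|s [k _ [/= <-]]//].
by exists (N s).
Qed.

Section right_approximation.
Context (R : realType).

(** For [t >= 0], the least multiple of [1/(n+1)] strictly above [t]; strictness is what makes these
    points converge to [t] along the filter of punctured right neighbourhoods. *)
Definition right_approx (n : nat) (t : R) : R :=
  (Num.truncn (t * n.+1%:R)).+1%:R / n.+1%:R.

Lemma right_approxP n t : 0 <= t ->
  t < right_approx n t /\ right_approx n t <= t + n.+1%:R^-1.
Proof.
move=> t0; have n0 : 0 < n.+1%:R :> R by [].
have /truncn_itv/andP[lo hi] : 0 <= t * n.+1%:R by rewrite mulr_ge0.
split; first by rewrite /right_approx ltr_pdivlMr.
by rewrite /right_approx ler_pdivrMr// mulrDl mulVf ?gt_eqF// -natr1 lerD2r.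
Qed.

Lemma right_approx_near t (Q : R -> Prop) : 0 <= t ->
  (\forall s \near t^'+, Q s) -> \forall n \near \oo, Q (right_approx n t).
Proof.
move=> t0; rewrite near_withinE => /nbhs_ballP[e /= e0 eQ].
near=> n; have [lo hi] := right_approxP n t0; apply: eQ => //.
rewrite /ball/= distrC gtr0_norm ?subr_gt0// ltrBlDl (le_lt_trans hi)// ltrD2l.
near: n; exact: near_infty_natSinv_lt (PosNum e0).
Unshelve. all: by end_near. Qed.

Lemma measurable_right_approx_index n k :
  measurable [set t : measurableTypeR R | Num.truncn (Num.max t 0 * n.+1%:R) = k].
Proof.
have n0 : 0 < n.+1%:R :> R by [].
pose y (t : measurableTypeR R) : R := Num.max t 0 * n.+1%:R.
have my : measurable_fun setT y.
  by apply: measurable_funM => //; exact: measurable_maxr.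
have := my measurableT _ (measurable_itv `[k%:R, k.+1%:R[); rewrite setTI.
congr measurable; apply/seteqP; split => t /=; rewrite in_itv/=.
  exact: truncn_def.
by move=> <-; apply: truncn_itv; rewrite mulr_ge0// le_max lexx orbT.
Qed.

End right_approximation.

Section borel_measurability.
Context (R : realType) (E : pmetricType R).

Lemma borel_measurable_open (d : measure_display) (S : measurableType d)
  (Y : S -> borel E) : (forall U : set E, open U -> measurable (Y @^-1` U)) ->
  measurable_fun setT Y.
Proof.
move=> mY; apply: (@measurability _ _ S (borel E) setT Y (@open E)) => //.
by move=> _ [U oU <-]; rewrite setTI; exact: mY.
Qed.

Lemma open_borel (U : set E) : open U -> measurable (U : set (borel E)).
Proof. by move=> oU; exact: sub_sigma_algebra. Qed.

Lemma continuous_borel (k : E -> R) : continuous k ->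
  measurable_fun setT (k : borel E -> R).
Proof.
move=> ck; apply: (measurability _ (RGenOpens.measurableE R)).
move=> _ [_ [a [b ->]] <-]; rewrite setTI.
apply: open_borel; apply: open_comp => [x _|]; first exact: ck.
exact: interval_open.
Qed.

Definition enlargement (A : set E) (e : R) : set E :=
  [set y | exists2 a, A a & mdist a y < e].

Lemma open_enlargement (A : set E) (e : R) : open (enlargement A e).
Proof.
rewrite openE => y [a Aa ay]; apply/metricType_numDomainType.nbhs_mdistP.
exists (e - mdist a y) => /=; first by rewrite subr_gt0.
move=> z /= yz; exists a => //.
by rewrite (le_lt_trans (metric_triangle a y z))// -ltrBrDl.
Qed.

Lemma enlargement_sub (A B : set E) (e e' : R) :
  A `<=` B -> e <= e' -> enlargement A e `<=` enlargement B e'.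
Proof. by move=> AB ee' y [a /AB Ba ay]; exists a => //; exact: lt_le_trans ee'. Qed.

Lemma closed_enlargement (A : set E) : closed A ->
  \bigcap_n enlargement A n.+1%:R^-1 = A.
Proof.
move=> cA; apply/seteqP; split => [y yA|y Ay n _]; last first.
  by exists y; rewrite // mdistxx invr_gt0.
apply: cA => B /metricType_numDomainType.nbhs_mdistP[e /= e0 eB].
have [n _ ne] := near_infty_natSinv_lt (PosNum e0).
have [a Aa ay] := yA n I; exists a; split => //; apply: eB => /=.
by rewrite metric_sym (lt_trans ay)//; apply: ne => /=.
Qed.

(* A limit of points lies in an open set [U] iff these points eventually keep
   a fixed distance from the complement of [U]. *)
Lemma measurable_cvg_borel (d : measure_display) (S : measurableType d)
  (Y_ : nat -> S -> borel E) (Y : S -> borel E) :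
  (forall n, measurable_fun setT (Y_ n)) ->
  (forall s, (Y_ n s : E) @[n --> \oo] --> (Y s : E)) -> measurable_fun setT Y.
Proof.
move=> mY cY; apply: borel_measurable_open => U oU.
pose V m : set (borel E) := ~` enlargement (~` U) m.+1%:R^-1.
have mV m : measurable (V m).
  by apply: measurableC; apply: open_borel; exact: open_enlargement.
have cl : closed (~` U) by exact: open_closedC.
have -> : Y @^-1` U = \bigcup_m \bigcup_K \bigcap_k (Y_ (K + k)%N @^-1` V m).
  apply/seteqP; split => s /=.
  - move=> Us; have : ~ (\bigcap_n enlargement (~` U) n.+1%:R^-1) (Y s).
      by rewrite closed_enlargement// => /(_ Us).
    move=> /existsNP[m /not_implyP[_ Ysm]].
    (* The gap between two consecutive radii absorbs the distance from the approximating points to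
       the limit. *)
    have m20 : 0 < (m.+1%:R^-1 : R) - (m.+2%:R)^-1.
      by rewrite subr_gt0 ltf_pV2 ?posrE// ltr_nat.
    have /metricType_numDomainType.cvgrPdist_lt /(_ _ m20)[K _ near] := cY s.
    exists m.+1 => //; exists K => // k _ /= -[a Ua aY]; apply: Ysm; exists a => //.
    have := near (K + k)%N (leq_addr _ _); rewrite metric_sym => YY.
    rewrite (le_lt_trans (metric_triangle _ (Y_ (K + k)%N s : E) _))//.
    by have := ltrD aY YY; rewrite [X in _ < X]addrC subrK.
  - move=> [m _ [K _ far]]; apply: contrapT => nU.
    have m0 : 0 < (m.+1%:R^-1 : R) by rewrite invr_gt0.
    have /metricType_numDomainType.cvgrPdist_lt /(_ _ m0)[n _ near] := cY s.
    apply: (far n I); exists (Y s : E) => //; apply: near => /=.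
    exact: leq_addl.
apply: bigcupT_measurable => m; apply: bigcupT_measurable => K.
apply: bigcapT_measurable => k.
by rewrite -[X in measurable X]setTI; exact: mY.
Qed.

End borel_measurability.

Section path_processes.
Context (R : realType) (E : pmetricType R).
Implicit Types (phi psi : R * E -> R).

(** Negative times are clipped to 0, so that measurability of the restriction to the half-space is
    stated on the whole product. *)
Definition measurable_half_space phi :=
  measurable_fun setT (fun p : measurableTypeR R * borel E => phi (Num.max p.1 0, p.2)).

Lemma cvg_half_space phi (T : Type) (Fi : set_system T) (FF : Filter Fi)
  (a : T -> R) (y : T -> E) (t : R) (x : E) : Cb_half_space phi -> 0 <= t ->
  a @ Fi --> t -> y @ Fi --> x -> (\forall i \near Fi, 0 <= a i) ->
  phi (a i, y i) @[i --> Fi] --> phi (t, x).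
Proof.
move=> [/subspace_continuousP cphi _] t0 ca cy a0.
have hs : half_space (t, x) by split => //=; rewrite in_itv/= t0.
apply: cvg_trans (cphi _ hs) => A /= [[B1 B2] [/= nB1 nB2] BA].
rewrite /nbhs/=.
have := ca _ nB1; have := cy _ nB2; rewrite /nbhs/=.
apply: filterS3 (a0) => i ai yi aai.
by apply: (BA (a i, y i)); [split|split => //=; rewrite in_itv/= ai].
Qed.

Lemma Cb_half_space_section phi t : Cb_half_space phi -> 0 <= t ->
  continuous (fun x => phi (t, x)).
Proof.
move=> cphi t0 x; apply: cvg_half_space => //; first exact: cvg_cst.
exact: nearW.
Qed.

(** Measurability refers to the product of the two Borel sigma-algebras. Discretizing time from the
    right reduces it to countably many sections, each continuous in the space variable, followed by
    a pointwise limit. *)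
Lemma Cb_half_space_measurable phi : Cb_half_space phi -> measurable_half_space phi.
Proof.
move=> cphi.
pose g (n : nat) (p : measurableTypeR R * borel E) : R :=
  phi (right_approx n (Num.max p.1 0), p.2).
have max0 (t : R) : 0 <= Num.max t 0 by rewrite le_max lexx orbT.
rewrite /measurable_half_space; apply: (@measurable_fun_cvg _ _ R setT g) => //; last first.
  move=> p _; apply: cvg_half_space => //.
  - apply: cvg_trans (cvg_at_right_filter (@cvg_id _ _)).
    by move=> A; exact: right_approx_near.
  - exact: cvg_cst.
  - by near=> n; apply: le_trans (max0 _) (ltW _); exact: (right_approxP _ (max0 _)).1.
move=> n.
pose N (p : measurableTypeR R * borel E) := Num.truncn (Num.max p.1 0 * n.+1%:R).
apply: (@measurable_select _ _ _ _ N
  (fun k p => phi (k.+1%:R / n.+1%:R, p.2))) => k.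
  rewrite -[X in measurable X]setTI.
  exact: (measurable_fst measurableT _ (measurable_right_approx_index n k)).
have /continuous_borel : continuous (fun x => phi (k.+1%:R / n.+1%:R, x)).
  by apply: Cb_half_space_section => //; rewrite divr_ge0.
by move=> mphi; apply: (measurableT_comp mphi); exact: measurable_snd.
Unshelve. all: by end_near. Qed.

Context (d : measure_display) (S : measurableType d) (X : R -> S -> E).
Hypothesis mX : forall t, 0 <= t -> measurable_fun setT (X t : S -> borel E).
Hypothesis rcX : forall w t, 0 <= t -> X s w @[s --> t^'+] --> X t w.

Let max0 (t : R) : 0 <= Num.max t 0. Proof. by rewrite le_max lexx orbT. Qed.

Lemma measurable_paths : measurable_fun setT
  (fun p : measurableTypeR R * S => X (Num.max p.1 0) p.2 : borel E).
Proof.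
pose Y_ n (p : measurableTypeR R * S) : borel E :=
  X (right_approx n (Num.max p.1 0)) p.2.
apply: (@measurable_cvg_borel _ _ _ _ Y_) => [n|p]; last first.
  move=> A /(rcX (max0 p.1)) /=; exact: right_approx_near.
pose N (p : measurableTypeR R * S) := Num.truncn (Num.max p.1 0 * n.+1%:R).
apply: (@measurable_select _ _ _ _ N
  (fun k p => X (k.+1%:R / n.+1%:R) p.2 : borel E)) => k.
  rewrite -[X in measurable X]setTI.
  exact: (measurable_fst measurableT _ (measurable_right_approx_index n k)).
apply: (@measurableT_comp _ _ _ _ _ _ (X (k.+1%:R / n.+1%:R) : S -> borel E)).
  by apply: mX; rewrite divr_ge0.
exact: measurable_snd.
Qed.

Lemma measurable_at_time (tau : S -> R) : measurable_fun setT tau ->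
  (forall w, 0 <= tau w) ->
  measurable_fun setT (fun w => X (tau w) w : borel E).
Proof.
move=> mtau tau0.
have mp : measurable_fun setT (fun w => (tau w : measurableTypeR R, w)).
  exact: measurable_fun_pair.
have := measurableT_comp measurable_paths mp; apply: eq_measurable_fun => w _ /=.
by rewrite max_l.
Qed.

Variable alpha : R.

(* Paths are frozen at their starting point before time 0, which makes the
   process jointly measurable on the whole of R * S. *)
Definition path_process phi s : R -> S -> R :=
  fun u w => expR (- alpha * u) * phi (s + Num.max u 0, X (Num.max u 0) w).

Lemma process_path phi s : 0 <= s -> measurable_half_space phi ->
  bounded_half_space phi -> process alpha (path_process phi s).
Proof.
move=> s0 mphi [M phiM]; split.
  apply: measurable_funM.
    apply: measurableT_comp; first exact: measurable_expR.
    by apply: measurable_funM => //; exact: measurable_fst.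
  have mp : measurable_fun setT (fun p : measurableTypeR R * S =>
      (s + Num.max p.1 0 : measurableTypeR R, X (Num.max p.1 0) p.2 : borel E)).
    have m1 : measurable_fun setT (fun p : measurableTypeR R * S => s + Num.max p.1 0 : R).
      apply: measurable_funD; first exact: measurable_cst.
      by apply: measurable_maxr; [exact: measurable_fst|exact: measurable_cst].
    by apply: measurable_fun_pair; [exact: m1|exact: measurable_paths].
  have := measurableT_comp mphi mp; apply: eq_measurable_fun => p _ /=.
  by rewrite (max_l (addr_ge0 s0 (max0 _))).
exists M => r w r0; rewrite /path_process normrM ger0_norm ?expR_ge0// mulrC.
by rewrite ler_wpM2r ?expR_ge0// phiM// addr_ge0.
Qed.

Lemma path_processE phi s u w : 0 <= u ->
  path_process phi s u w = expR (- alpha * u) * phi (s + u, X u w).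
Proof. by move=> u0; rewrite /path_process max_l. Qed.

Lemma path_process_right_continuous phi s w t : 0 <= s -> 0 <= t ->
  Cb_half_space phi ->
  path_process phi s r w @[r --> t^'+] --> path_process phi s t w.
Proof.
move=> s0 t0 cphi; rewrite path_processE//.
have ct : r @[r --> t^'+] --> t by apply: cvg_at_right_filter; exact: cvg_id.
have r0 : \forall r \near t^'+, 0 <= r.
  by near=> r; rewrite (le_trans t0)//; near: r; exact: nbhs_right_ge.
apply: (@cvg_trans _ ((fun r => expR (- alpha * r) * phi (s + r, X r w)) @ t^'+)).
  apply: near_eq_cvg; near=> r; rewrite path_processE//; near: r; exact: r0.
apply: cvgM.
  apply: cvg_at_right_filter; apply: continuous_comp; last exact: continuous_expR.
  by apply: continuousM => //; exact: cst_continuous.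
apply: cvg_half_space => //.
- exact: addr_ge0.
- by apply: cvgD => //; exact: cvg_cst.
- exact: rcX.
- by near=> r; rewrite addr_ge0//; near: r; exact: r0.
Unshelve. all: by end_near. Qed.

End path_processes.

(** * The exit time *)

Section announced_exit.
Context (R : realType) (E : pmetricType R).
Context (d : measure_display) (Omega : measurableType d).
Variables (X : R -> Omega -> E) (O : set E).
Hypothesis rcX : forall w t, 0 <= t -> X s w @[s --> t^'+] --> X t w.

Local Notation C n := (enlargement (~` O) n.+1%:R^-1).

Definition hit (n : nat) (w : Omega) : \bar R :=
  ereal_inf (EFin @` [set t : R | 0 <= t /\ C n (X t w)]).

(* Almost surely equal to the exit time, but measurable for the uncompleted
   sigma-algebra of the paths. *)
Definition announced_exit (w : Omega) : \bar R := ereal_sup (range (hit ^~ w)).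

Local Notation T := announced_exit.

Lemma hit_ge0 n w : (0 <= hit n w)%E.
Proof. by apply: le_ereal_inf_tmp => _ [t [t0 _] <-]; rewrite lee_fin. Qed.

Lemma hit_le n w t : 0 <= t -> C n (X t w) -> (hit n w <= t%:E)%E.
Proof. by move=> t0 Ct; apply: ereal_inf_lbound; exists t. Qed.

Lemma hit_ltP n w (b : \bar R) : (hit n w < b)%E ->
  exists t, [/\ 0 <= t, (t%:E < b)%E & C n (X t w)].
Proof.
move=> /ereal_inf_lt[_ [t [t0 Ct] <-] tb]; by exists t.
Qed.

Lemma hit_leS n w : (hit n w <= hit n.+1 w)%E.
Proof.
apply: le_ereal_inf_tmp => _ [t [t0 Ct] <-]; apply: hit_le => //.
apply: enlargement_sub Ct => //.
by rewrite lef_pV2 ?posrE// ler_nat.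
Qed.

Lemma hit_le_announced n w : (hit n w <= T w)%E.
Proof. by apply: ereal_sup_ubound; exists n. Qed.

Lemma announced_le w (b : \bar R) : (forall n, hit n w <= b)%E -> (T w <= b)%E.
Proof. by move=> hb; apply: ge_ereal_sup => _ [n _ <-]. Qed.

Lemma announced_exit_le w : (T w <= exit_time X O w)%E.
Proof.
apply: announced_le => n; apply: le_ereal_inf_tmp => _ [t [t0 Ot] <-].
by apply: hit_le => //; exists (X t w); rewrite // mdistxx invr_gt0.
Qed.


Lemma hit_le_leq n m w : (n <= m)%N -> (hit n w <= hit m w)%E.
Proof.
elim: m => [|m IH]; first by rewrite leqn0 => /eqP ->.
rewrite leq_eqVlt => /predU1P[->//|nm].
exact: le_trans (IH nm) (hit_leS m w).
Qed.

Lemma lt_announced n w t : (t%:E < T w)%E -> exists2 m, (n <= m)%N & (t%:E < hit m w)%E.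
Proof.
move=> /ereal_sup_gt[_ [m _ <-] tm]; exists (maxn n m); first exact: leq_maxl.
exact: lt_le_trans tm (hit_le_leq w (leq_maxr n m)).
Qed.

(** A right-continuous path that is in an open set at time [r] remains there on some interval to the
    right of [r], hence at a rational grid point before [t]. *)
Lemma hit_grid n w t : (hit n w < t%:E)%E -> exists m k : nat,
  k%:R / m.+1%:R < t /\ C n (X (k%:R / m.+1%:R) w).
Proof.
move=> /hit_ltP[r [r0 rt Cr]]; rewrite lte_fin in rt.
have Cn : \forall s \near r^'+, C n (X s w).
  have nC : nbhs (X r w) (C n).
    by apply: open_nbhs_nbhs; split => //; exact: open_enlargement.
  exact: (rcX r0 nC).
have tn : \forall s \near r^'+, s < t by exact: nbhs_right_lt.
have [m _ mP] := filterI (right_approx_near r0 Cn) (right_approx_near r0 tn).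
have [] := mP m (leqnn m); rewrite /right_approx => Cm mt.
by exists m, (Num.truncn (r * m.+1%:R)).+1.
Qed.

Lemma announced_hit_shift n w t (theta : R -> Omega -> Omega) : 0 <= t ->
  (forall s, 0 <= s -> X s (theta t w) = X (t + s) w) ->
  (t%:E <= hit n w)%E -> (hit n (theta t w) + t%:E = hit n w)%E.
Proof.
move=> t0 sh tn; apply: le_anti; apply/andP; split.
  apply: le_ereal_inf_tmp => _ [r [r0 Cr] <-].
  have tr : t <= r.
    by rewrite -lee_fin (le_trans tn)// hit_le.
  rewrite -leeBrDr// -EFinB; apply: hit_le; first by rewrite subr_ge0.
  by rewrite sh ?subr_ge0// addrC subrK.
rewrite -leeBlDr//; apply: le_ereal_inf_tmp => _ [r [r0 Cr] <-].
rewrite leeBlDr// -EFinD; apply: hit_le; first exact: addr_ge0.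
by rewrite addrC -sh.
Qed.

(** The hitting times increase to [T], so [t < T] places all those of large index after [t]; these
    commute with the shift and determine the supremum. *)
Lemma announced_shift w t (theta : R -> Omega -> Omega) : 0 <= t ->
  (forall s, 0 <= s -> X s (theta t w) = X (t + s) w) ->
  (t%:E < T w)%E -> (T (theta t w) + t%:E = T w)%E.
Proof.
move=> t0 sh tT; apply: le_anti; apply/andP; split.
  rewrite -leeBrDr//; apply: announced_le => n; rewrite leeBrDr//.
  have [m nm tm] := lt_announced n tT.
  apply: (@le_trans _ _ (hit m (theta t w) + t%:E)%E).
    by rewrite leeD2r// hit_le_leq.
  by rewrite announced_hit_shift// ?(ltW tm)// hit_le_announced.
apply: announced_le => n; have [m nm tm] := lt_announced n tT.
rewrite (le_trans (hit_le_leq w nm))//.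
rewrite -(@announced_hit_shift m w t theta)// ?(ltW tm)// leeD2r//.
exact: hit_le_announced.
Qed.

Lemma announced_ge0 w : (0 <= T w)%E.
Proof. exact: le_trans (hit_ge0 0 w) (hit_le_announced 0 w). Qed.

(** The infimum need not be attained, so the position at the hitting time may lie outside the
    neighbourhood; right continuity costs a second radius, hence the factor 2. *)
Lemma hit_near n w : (hit n w < +oo)%E ->
  exists2 c, ~ O c & mdist c (X (fine (hit n w)) w) < 2 / n.+1%:R.
Proof.
move=> hfin; set t := fine (hit n w).
have ht : hit n w = t%:E by rewrite fineK// ge0_fin_numE// hit_ge0.
have t0 : 0 <= t by rewrite -lee_fin -ht hit_ge0.
have n0 : 0 < (n.+1%:R^-1 : R) by rewrite invr_gt0.
have /metricType_numDomainType.cvgrPdist_lt /(_ _ n0) := rcX (w := w) t0.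
rewrite near_withinE => /nbhs_ballP[e /= e0 eX].
have [|r [r0 rt [c Oc cr]]] := @hit_ltP n w (t + e)%:E.
  by rewrite ht lte_fin ltrDl.
exists c => //; rewrite lte_fin in rt.
have tr : t <= r by rewrite -lee_fin -ht hit_le//; exists c.
rewrite (le_lt_trans (metric_triangle _ (X r w) _))// mulr_natl mulr2n ltrD//.
have [->|nrt] := eqVneq r t; first by rewrite mdistxx.
rewrite metric_sym; apply: eX; last by rewrite lt_neqAle eq_sym nrt.
by rewrite /ball/= distrC ger0_norm ?subr_ge0// ltrBlDl.
Qed.

Section stopping.
Variable F : R -> set (set Omega).
Hypotheses (filF : filtration F) (rcF : right_continuous_filtration F).
Hypothesis adX : adapted F X.

Lemma hit_lt_filtration n t : 0 <= t -> F t [set w | (hit n w < t%:E)%E].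
Proof.
move=> t0.
rewrite (_ : [set w | _] = \bigcup_m \bigcup_k
    (if k%:R / m.+1%:R < t then X (k%:R / m.+1%:R) @^-1` C n else set0)).
  apply: filtration_bigcup => // m; apply: filtration_bigcup => // k.
  case: ifPn => [kt|_]; last exact: filtration0.
  have km0 : 0 <= k%:R / m.+1%:R :> R by rewrite divr_ge0.
  apply: filtrationW (ltW kt) _ => //; apply: adX => //.
  by apply: open_borel; exact: open_enlargement.
apply/seteqP; split => w /=.
  by move=> /hit_grid[m [k [kt Ck]]]; exists m => //; exists k => //; rewrite kt.
move=> [m _ [k _]]; case: ifPn => // kt Ck.
by rewrite (le_lt_trans (hit_le _ Ck)) ?lte_fin// divr_ge0.
Qed.

Lemma hit_stopping n : stopping_time F (hit n).
Proof.
split => [w|t t0]; first exact: hit_ge0.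
rewrite rcF// => u /=; rewrite in_itv/= andbT => tu.
have ut0 : 0 < u - t by rewrite subr_gt0.
(* The thresholds decrease to [t] and never exceed [u], so each event lies in [F u]; right
   continuity of the filtration then descends to [F t]. *)
rewrite (_ : [set w | _] = \bigcap_m [set w | (hit n w < (t + (u - t) / m.+1%:R)%:E)%E]).
  have u0 : 0 <= u by rewrite (le_trans t0)// ltW.
  apply: (filtration_bigcap filF u0) => m.
  have tm0 : 0 <= t + (u - t) / m.+1%:R by rewrite addr_ge0// divr_ge0// ltW.
  apply: filtrationW (hit_lt_filtration n tm0) => //.
  by rewrite -lerBrDl ler_piMr ?(ltW ut0)// invf_le1// ler1n.
apply/seteqP; split => w /=.
  by move=> ht m _ /=; rewrite (le_lt_trans ht)// lte_fin ltrDl divr_gt0.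
move=> ht; apply/lee_addgt0Pr => e e0.
have eu0 : 0 < e / (u - t) by rewrite divr_gt0.
have [m _ /(_ m (leqnn m)) me] := near_infty_natSinv_lt (PosNum eu0).
rewrite ltW// (lt_le_trans (ht m I))// -EFinD lee_fin lerD2l.
by rewrite mulrC -ler_pdivlMr// ltW.
Qed.

Lemma announced_stopping : stopping_time F T.
Proof.
split => [w|t t0]; first exact: announced_ge0.
rewrite (_ : [set w | _] = \bigcap_n [set w | (hit n w <= t%:E)%E]).
  by apply: filtration_bigcap => // n; exact: (hit_stopping n).2.
apply/seteqP; split => w /=.
  by move=> Tt n _ /=; exact: le_trans (hit_le_announced n w) Tt.
by move=> ht; apply: announced_le => n; exact: ht.
Qed.

(** Quasi-left-continuity makes the positions at the hitting times converge to the position at [T];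
    they come arbitrarily close to the complement of [O], which is closed. *)
Lemma announced_negligible (P : E -> probability Omega R) x : open O ->
  quasi_left_continuous P F X ->
  {ae P x, forall w, (T w < +oo)%E -> ~ O (X (fine (T w)) w)}.
Proof.
move=> oO /(_ hit T hit_stopping hit_leS (fun=> erefl) x); apply: filterS.
move=> w cX Tfin; have cl : closed (~` O) by exact: open_closedC.
move/(_ Tfin) in cX; apply: (cl).
move=> B /metricType_numDomainType.nbhs_mdistP[e /= e0 eB].
have e20 : 0 < e / 2 by rewrite divr_gt0.
have e40 : 0 < e / 4 by rewrite divr_gt0.
have /metricType_numDomainType.cvgrPdist_lt /(_ _ e20) near1 := cX.
have [n _ /(_ n (leqnn n)) [n1 n2]] := filterI near1 (near_infty_natSinv_lt (PosNum e40)).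
have [|c Oc cn] := @hit_near n w; first exact: le_lt_trans (hit_le_announced n w) Tfin.
exists c; split => //; apply: eB => /=.
rewrite (le_lt_trans (metric_triangle _ (X (fine (hit n w)) w) _))//.
rewrite /= in n2.
have c2 : mdist (X (fine (hit n w)) w) c < e / 2.
  rewrite metric_sym (lt_trans cn)//.
  have -> : e / 2 = 2 * (e / 4) by field.
  by rewrite ltr_pM2l.
by rewrite [ltRHS](splitr e) ltrD.
Qed.

End stopping.

End announced_exit.

(** * The Markov property *)

Section translation.
Context (R : realType) (alpha : R).
Hypothesis alpha_gt0 : 0 < alpha.

Lemma damped_translate phi t : 0 <= t -> damped alpha phi ->
  damped alpha (fun u => phi (t + u)).
Proof.
move=> t0 [mphi [C phiC]]; split.
  by apply: (measurableT_comp mphi); apply: measurable_funD.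
exists (C * expR (- alpha * t)) => r r0.
by rewrite -mulrA -expRD -mulrDr phiC// addr_ge0.
Qed.

Lemma Itg_translate phi t (b : \bar R) : 0 <= t -> damped alpha phi ->
  Itg (fun u => phi (t + u)) 0 b = Itg phi t (b + t%:E).
Proof.
move=> t0 dphi; have [mphi _] := dphi.
pose sh : measurableTypeR R -> measurableTypeR R := fun u => t + u.
have msh : measurable_fun setT sh by apply: measurable_funD.
have mD := measurable_seg t (b + t%:E)%E.
have shD : sh @^-1` seg t (b + t%:E)%E = seg 0 b.
  apply/seteqP; split => u; rewrite /seg/= /sh lerDl EFinD addeC lteD2rE//.
rewrite /Itg /Rintegral -shD; congr fine.
have mE : measurable_fun setT (EFin \o phi : measurableTypeR R -> \bar R).
  exact/measurable_EFinP.
have ii : lebesgue_measure.-integrable (sh @^-1` seg t (b + t%:E)%E)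
    ((EFin \o phi) \o sh).
  by rewrite shD; exact: (damped_integrable alpha_gt0 b (lexx 0) (damped_translate t0 dphi)).
(* Translation invariance of Lebesgue measure: its image under the shift agrees with it on half-open
   intervals, hence on all Borel sets. *)
rewrite -[LHS](integral_pushforward msh mE ii mD).
apply: eq_measure_integral => A mA _; symmetry.
apply: lebesgue_measure_unique => // _ [[x y] _ <-].
have shE : sh @^-1` `]x, y]%classic = `]x - t, y - t]%classic.
  by apply/seteqP; split => u /=; rewrite /sh !in_itv/= ltrBlDl lerBrDl.
transitivity (lebesgue_measure (sh @^-1` `]x, y]%classic)); last by [].
rewrite shE lebesgue_measure_itv/= [RHS]lebesgue_measure_itv/= !lte_fin ltrD2r.
by case: ifP => // _; rewrite -!EFinD; congr EFin; ring.
Qed.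

End translation.

Section payoffs.
Context (R : realType) (E : pmetricType R).
Context (d : measure_display) (S : measurableType d) (X : R -> S -> E).
Hypothesis mX : forall t, 0 <= t -> measurable_fun setT (X t : S -> borel E).
Hypothesis rcX : forall w t, 0 <= t -> X s w @[s --> t^'+] --> X t w.
Variable alpha : R.
Hypothesis alpha_gt0 : 0 < alpha.
Implicit Types (phi : R * E -> R) (tau : S -> \bar R).

(** [running] includes a finite end point and [Itg] does not; a single point has measure zero. *)
Lemma running_Itg phi s w (b : \bar R) : 0 <= s -> measurable_half_space phi ->
  bounded_half_space phi ->
  running X alpha phi s b w = Itg (path_process X alpha phi s ^~ w) 0 b.
Proof.
move=> s0 mphi bphi.
have pp := process_path mX rcX alpha s0 mphi bphi.
have ii := damped_integrable alpha_gt0 b (lexx 0) (process_damped w pp).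
rewrite /running /Itg.
transitivity (\int[lebesgue_measure]_(u in [set u : R | 0 <= u /\ (u%:E <= b)%E])
    path_process X alpha phi s u w).
  by apply: eq_Rintegral => u; rewrite inE => -[u0 _]; rewrite path_processE.
case: b ii => [r| |] ii.
- rewrite (_ : [set u | _] = `[0, r]%classic); last first.
    apply/seteqP; split => u /=; rewrite in_itv/= lee_fin.
      by move=> [-> ->].
    by move=> /andP.
  by rewrite segE in ii *; rewrite Rintegral_itv_bndo_bndc.
- by congr Rintegral; apply/seteqP; split => u /= [u0 _]; split => //; rewrite ?leey ?ltry.
- by congr Rintegral; apply/seteqP; split => u /= [u0]; rewrite ?leeNy_eq ?ltNge ?leNye.
Qed.

Lemma terminalE phi s w (b : \bar R) : (0 <= b)%E ->
  terminal X alpha phi s b w =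
  if (b < +oo)%E then path_process X alpha phi s (fine b) w else 0.
Proof.
case: b => [r| |]// r0.
by rewrite lee_fin in r0; rewrite ltry path_processE.
Qed.

Lemma terminal_bm phi s tau : 0 <= s -> measurable_half_space phi ->
  bounded_half_space phi -> measurable_fun setT tau -> (forall w, 0 <= tau w)%E ->
  bounded_measurable (fun w => terminal X alpha phi s (tau w) w).
Proof.
move=> s0 mphi bphi mtau tau0; have pp := process_path mX rcX alpha s0 mphi bphi.
under eq_fun do rewrite terminalE//.
apply: bm_if; first exact: measurable_fun_lte.
- exact: (bm_eval alpha_gt0 pp).
- exact: bm_cst.
Qed.

End payoffs.

Lemma Rintegral_ae (R : realType) (d : measure_display) (S : measurableType d)
  (P : probability S R) (f g : S -> R) : bounded_measurable f ->
  bounded_measurable g -> {ae P, forall w, f w = g w} ->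
  \int[P]_w f w = \int[P]_w g w.
Proof.
move=> [mf _] [mg _] fg; congr fine; apply: ae_eq_integral => //.
- exact/measurable_EFinP.
- exact/measurable_EFinP.
- by apply: filterS fg => w -> _.
Qed.

(** * Almost sure identification of the exit time with the announced one *)

Section markov.
Context (R : realType) (E : pmetricType R).
Context (d : measure_display) (Omega : measurableType d).
Context (P : E -> probability Omega R) (F : R -> set (set Omega)).
Context (X : R -> Omega -> E) (theta : R -> Omega -> Omega) (O : set E).
Hypothesis smp : standard_markov_process P F X theta.
Hypothesis oO : open O.

Local Notation T := (announced_exit X O).

Let filF := smp_filtration smp.

Lemma smp_right_cvg w t : 0 <= t -> X s w @[s --> t^'+] --> X t w.
Proof. by move=> t0; exact: (smp_cadlag smp w).1. Qed.

Lemma smp_measurable t : 0 <= t -> measurable_fun setT (X t : Omega -> borel E).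
Proof.
move=> t0 _ B mB; rewrite setTI; apply: (filtration_measurable filF t0).
exact: (smp_adapted smp t0 mB).
Qed.

(** [Omega] with only the sigma-algebra generated by the paths: general results on processes, read
    on this space, give the [sigma_paths] measurability that [strong_markov] demands. *)
Definition path_space := g_sigma_algebraType
  [set A : set Omega | exists t : R, 0 <= t /\
        exists2 B : set (borel E), measurable B & A = X t @^-1` B].

Lemma path_space_measurable t : 0 <= t ->
  measurable_fun setT (X t : path_space -> borel E).
Proof.
move=> t0 _ B mB; rewrite setTI; apply: sub_sigma_algebra.
by exists t; split => //; exists B.
Qed.

(* Viewing [sigma_paths X] as a constant filtration makes the measurability of
   [announced_exit] for the paths a case of [announced_stopping]. *)
Lemma sigma_paths_filtration : filtration (fun _ : R => sigma_paths X).
Proof.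
split => [t t0|s t _ _ A //]; split; first exact: smallest_sigma_algebra.
apply: smallest_sub; first exact: sigma_algebra_measurable.
move=> _ [r [r0 [B mB ->]]]; rewrite -[X in measurable X]setTI.
exact: smp_measurable.
Qed.

Lemma announced_exit_stopping : stopping_time F T.
Proof.
apply: announced_stopping => //; first exact: smp_right_cvg.
- exact: smp_right_continuous smp.
- exact: smp_adapted smp.
Qed.

Lemma announced_exit_path_measurable :
  measurable_fun setT (T : path_space -> \bar R).
Proof.
have st : stopping_time (fun _ : R => sigma_paths X) T.
  apply: (announced_stopping O smp_right_cvg sigma_paths_filtration).
    move=> t t0; apply/seteqP; split => [A FA u _//|A].
    by move=> /(_ (t + 1)); apply; rewrite /= in_itv/= andbT ltrDl.
  move=> t t0 B mB; apply: sub_sigma_algebra.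
  by exists t; split => //; exists B.
apply: measurable_from_gt => t; have [t0|t0] := leP 0 t.
  exact: (stopping_timeC sigma_paths_filtration st t0).
suff -> : [set w : path_space | (t%:E < T w)%E] = setT by exact: measurableT.
apply/seteqP; split => // w _ /=.
by rewrite (lt_le_trans _ (announced_ge0 _ _ w))// lte_fin.
Qed.

Lemma exit_time_le w : (T w < +oo)%E -> ~ O (X (fine (T w)) w) ->
  exit_time X O w = T w.
Proof.
move=> Tfin nO; apply: le_anti; rewrite announced_exit_le andbT.
have T0 := announced_ge0 X O w.
rewrite -[leRHS]fineK ?ge0_fin_numE//; apply: ereal_inf_lbound.
by exists (fine (T w)) => //; split => //; exact: fine_ge0.
Qed.

Let bad := [set w | (T w < +oo)%E /\ O (X (fine (T w)) w)].

Let exit_time_good w : ~ bad w -> exit_time X O w = T w.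
Proof.
move=> nb; have [Ty|Ty] := ltP (T w) +oo%E.
  by apply: exit_time_le => // OX; exact: nb.
apply: le_anti; rewrite announced_exit_le andbT.
by rewrite (le_trans _ Ty)// leey.
Qed.

Let announced_exit_measurable : measurable_fun setT T.
Proof. exact: (stopping_time_measurable filF announced_exit_stopping). Qed.

Let measurable_bad : measurable bad.
Proof.
apply: measurableI.
  rewrite -[X in measurable X]setTI; exact: emeasurable_fun_infty_o.
have mf : measurable_fun setT (fun w => fine (T w)).
  exact: (measurableT_comp (fine_measurable measurableT)).
have f0 w : 0 <= fine (T w) by apply: fine_ge0; exact: announced_ge0.
have := measurable_at_time smp_measurable smp_right_cvg mf f0.
move=> /(_ measurableT _ (open_borel oO)); rewrite setTI; exact.
Qed.

Let bad0 x : P x bad = 0%E.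
Proof.
have [N [mN N0 sub]] := announced_negligible smp_right_cvg filF
  (smp_right_continuous smp) (smp_adapted smp) x oO (smp_quasi_left_continuous smp).
apply/eqP; rewrite eq_le measure_ge0 andbT -N0 le_measure ?inE//.
by move=> w [Ty OX]; apply: sub => /= /(_ Ty).
Qed.

Lemma exit_time_ae x : {ae P x, forall w, exit_time X O w = T w}.
Proof.
exists bad; split => // w /=; apply: contra_notP => nb.
exact: exit_time_good.
Qed.

(** The exit time differs from the stopping time [T] only on [bad], which is null from every
    starting point, hence under every initial law; completeness of the filtration does the rest. *)
Lemma exit_time_stopping : stopping_time F (exit_time X O).
Proof.
split => [w|t t0]; first exact: le_trans (announced_ge0 _ _ _) (announced_exit_le _ _ _).
apply: (smp_complete smp t0) => mu.
exists [set w | (T w <= t%:E)%E]; first exact: announced_exit_stopping.2.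
exists bad; split => //.
  by rewrite /initial_law; apply: integral0_eq => x _.
move=> w /= [[et Tt]|[Tt et]]; apply: contrapT => /exit_time_good ew.
  by apply: Tt; rewrite -ew.
by apply: et; rewrite ew.
Qed.

End markov.

Section markov_dynamics.
Context (R : realType) (E : pmetricType R).
Context (d : measure_display) (Omega : measurableType d).
Context (P : E -> probability Omega R) (F : R -> set (set Omega)).
Context (X : R -> Omega -> E) (theta : R -> Omega -> Omega) (O : set E).
Hypothesis smp : standard_markov_process P F X theta.
Hypothesis oO : open O.
Variables (alpha : R) (g H v : R * E -> R).
Hypothesis alpha_gt0 : 0 < alpha.
Hypotheses (mg : measurable_half_space g) (bg : bounded_half_space g).
Hypotheses (mH : measurable_half_space H) (bH : bounded_half_space H).
Hypotheses (mv : measurable_half_space v) (bv : bounded_half_space v).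
Hypothesis vP : forall s x, 0 <= s -> v (s, x) = \int[P x]_w
  (running X alpha g s (exit_time X O w) w +
   terminal X alpha H s (exit_time X O w) w).

Local Notation T := (announced_exit X O).
Let filF := smp_filtration smp.
Let rcX := @smp_right_cvg _ _ _ _ _ _ _ _ smp.
Let mX := @smp_measurable _ _ _ _ _ _ _ _ smp.
Let stT := announced_exit_stopping O smp.
Let mT := stopping_time_measurable filF stT.

Let Y s w := Itg (path_process X alpha g s ^~ w) 0 (T w) +
  terminal X alpha H s (T w) w.

Let bmY s : 0 <= s -> bounded_measurable (Y s).
Proof.
move=> s0; apply: bmD.
  exact: (process_Itg_bm alpha_gt0 (lexx 0) (process_path mX rcX alpha s0 mg bg) mT).
exact: (terminal_bm mX rcX alpha_gt0 s0 mH bH mT (announced_ge0 X O)).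
Qed.

Let path_measurable_Y s : 0 <= s -> forall B : set R, measurable B ->
  sigma_paths X (Y s @^-1` B).
Proof.
move=> s0 B mB.
have mXp := @path_space_measurable _ _ _ _ X.
have mTp := announced_exit_path_measurable O smp.
have rcXp : forall (w : path_space X) t, 0 <= t -> X s w @[s --> t^'+] --> X t w by exact: rcX.
have pp := process_path mXp rcXp alpha s0 mg bg.
have [mY _] : bounded_measurable (Y s : path_space X -> R).
  apply: bmD; first exact: (process_Itg_bm alpha_gt0 (lexx 0) pp mTp).
  exact: (terminal_bm mXp rcXp alpha_gt0 s0 mH bH mTp (announced_ge0 X O)).
by have := mY measurableT B mB; rewrite setTI.
Qed.

Lemma value_announced s x : 0 <= s -> v (s, x) = \int[P x]_w Y s w.
Proof.
move=> s0; rewrite vP//.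
have ste := exit_time_stopping smp oO.
have me := stopping_time_measurable filF ste.
have pp := process_path mX rcX alpha s0 mg bg.
transitivity (\int[P x]_w (Itg (path_process X alpha g s ^~ w) 0 (exit_time X O w) +
    terminal X alpha H s (exit_time X O w) w)).
  by apply: eq_Rintegral => w _; rewrite (running_Itg mX rcX alpha_gt0).
apply: Rintegral_ae.
- apply: bmD; first exact: (process_Itg_bm alpha_gt0 (lexx 0) pp me).
  exact: (terminal_bm mX rcX alpha_gt0 s0 mH bH me ste.1).
- exact: bmY.
- by apply: filterS (exit_time_ae smp oO x) => w; rewrite /Y => ->.
Qed.

(** A payoff counted from time [t] is discounted from [t] instead of 0, whence the factor
    [expR (alpha * t)]; the end points match because [T] commutes with the shift before [T]. *)
Lemma shifted_payoff s t w : 0 <= s -> 0 <= t -> (t%:E < T w)%E ->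
  Y (s + t) (theta t w) = expR (alpha * t) *
    (Itg (path_process X alpha g s ^~ w) t (T w) + terminal X alpha H s (T w) w).
Proof.
move=> s0 t0 tT.
have sh r : 0 <= r -> X r (theta t w) = X (t + r) w.
  by move=> r0; exact: (smp_shift smp).
have Tsh : (T (theta t w) + t%:E = T w)%E by exact: (announced_shift t0 sh tT).
have pp := process_path mX rcX alpha s0 mg bg.
have dp := process_damped w pp.
have st0 : 0 <= s + t by exact: addr_ge0.
rewrite /Y mulrDr; congr (_ + _).
  rewrite -Tsh -(Itg_translate alpha_gt0 _ t0 dp).
  rewrite -(ItgZ alpha_gt0 _ _ (lexx 0) (damped_translate t0 dp)).
  apply: eq_Rintegral => u; rewrite inE => -[u0 _].
  rewrite !path_processE ?addr_ge0// sh// mulrA -expRD addrA.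
  by congr (expR _ * _); ring.
move: Tsh (announced_ge0 X O (theta t w)); case: (T (theta t w)) => [r| |]//.
  rewrite -EFinD => <-; rewrite lee_fin => r0 /=.
  rewrite sh// mulrA -expRD [t + r]addrC [r + t]addrC addrA.
  by congr (expR _ * _); ring.
by rewrite addye// => <- _ /=; rewrite mulr0.
Qed.

Lemma markov_dynamics s x : 0 <= s ->
  dynamics (P x) F T (fun w => terminal X alpha H s (T w) w)
    (path_process X alpha g s) (path_process X alpha v s).
Proof.
move=> s0 t A t0 FA At.
have mA := filtration_measurable filF t0 FA.
have st0 : 0 <= s + t by exact: addr_ge0.
have pv := process_path mX rcX alpha s0 mv bv.
have bvt := process_bm t0 pv.
have pp := process_path mX rcX alpha s0 mg bg.
have bI : bounded_measurable (fun w => Itg (path_process X alpha g s ^~ w) t (T w) +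
    terminal X alpha H s (T w) w).
  apply: bmD; first exact: (process_Itg_bm alpha_gt0 t0 pp mT).
  exact: (terminal_bm mX rcX alpha_gt0 s0 mH bH mT (announced_ge0 X O)).
have sA : stopped_sigma_algebra F (fun=> t%:E) A.
  split=> // r r0; have [tr|rt] := leP t r.
    rewrite (_ : _ `&` _ = A); first exact: filtrationW FA.
    by apply/seteqP; split => [w []//|w Aw]; split => //=; rewrite lee_fin.
  rewrite (_ : _ `&` _ = set0); first exact: filtration0.
  by apply/seteqP; split => // w [_] /=; rewrite lee_fin leNgt rt.
have := smp_strong_markov smp (stopping_time_cst filF t0) sA
  (path_measurable_Y st0) (bmY st0).2 x.
have -> : A `&` [set w : Omega | (t%:E < +oo)%E] = A.
  by apply/seteqP; split => [w []//|w Aw]; split => //=; rewrite ltry.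
have et0 : expR (alpha * t) != 0 by rewrite gt_eqF ?expR_gt0.
move=> sm; apply: (mulfI et0).
rewrite -!bm_RintegralZ//.
transitivity (\int[P x]_(w in A) \int[P (X t w)]_v0 Y (s + t) v0).
  apply: eq_Rintegral => w _; rewrite -value_announced// path_processE//.
  by rewrite mulrA -expRD mulNr subrr expR0 mul1r.
rewrite -sm; apply: eq_Rintegral => w /set_mem /At /= tT.
exact: shifted_payoff.
Qed.

End markov_dynamics.

(** * The penalized values *)

Section penalized_value.
Context (R : realType) (E : pmetricType R).
Context (d : measure_display) (Omega : measurableType d).
Context (P : E -> probability Omega R) (F : R -> set (set Omega)).
Context (X : R -> Omega -> E) (theta : R -> Omega -> Omega) (O : set E).
Context (alpha : R) (f G H : R * E -> R) (wbeta : R -> R * E -> R).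
Hypothesis smp : standard_markov_process P F X theta.
Hypothesis oO : open O.
Hypothesis alpha_gt0 : 0 < alpha.
Hypotheses (f_Cb : Cb_half_space f) (G_Cb : Cb_half_space G) (H_Cb : Cb_half_space H).
Hypothesis wbetaP : forall beta : R, 0 < beta ->
  penalized_solution P X O alpha f G H beta (wbeta beta).

Local Notation T := (announced_exit X O).
Local Notation term s := (fun w => terminal X alpha H s (T w) w).
Local Notation path := (path_process X alpha).
Let filF := smp_filtration smp.
Let rcX := @smp_right_cvg _ _ _ _ _ _ _ _ smp.
Let mX := @smp_measurable _ _ _ _ _ _ _ _ smp.
Let stT := announced_exit_stopping O smp.
Let mT := stopping_time_measurable filF stT.
Let mf := Cb_half_space_measurable f_Cb.
Let mG := Cb_half_space_measurable G_Cb.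
Let mH := Cb_half_space_measurable H_Cb.

Let bmh s : 0 <= s -> bounded_measurable (term s).
Proof.
by move=> s0; exact: (terminal_bm mX rcX alpha_gt0 s0 mH H_Cb.2 mT (announced_ge0 X O)).
Qed.

Let process_f s : 0 <= s -> process alpha (path f s).
Proof. by move=> s0; exact: (process_path mX rcX alpha s0 mf f_Cb.2). Qed.

Let process_G s : 0 <= s -> process alpha (path G s).
Proof. by move=> s0; exact: (process_path mX rcX alpha s0 mG G_Cb.2). Qed.

Lemma wbeta_measurable beta : 0 < beta -> measurable_half_space (wbeta beta).
Proof.
move=> /wbetaP[mv _ _].
have m1 : measurable_fun setT (fun p : measurableTypeR R * borel E => (Num.max p.1 0, p.2)).
  apply: measurable_fun_pair; last exact: measurable_snd.
  by apply: measurable_maxr; [exact: measurable_fst|exact: measurable_cst].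
apply: (measurable_comp _ _ mv m1).
  by apply: measurableX => //; exact: measurable_itv.
by move=> _ [p _ <-]; split => //=; rewrite in_itv/= andbT le_max lexx orbT.
Qed.

Let process_w beta s : 0 < beta -> 0 <= s -> process alpha (path (wbeta beta) s).
Proof.
move=> b0 s0; have [_ bw _] := wbetaP b0.
exact: (process_path mX rcX alpha s0 (wbeta_measurable b0) bw).
Qed.

Lemma path_penalized beta s :
  path (fun z => f z + beta * Num.max (G z - wbeta beta z) 0) s =
  penalized (path f s) (path G s) (path (wbeta beta) s) beta.
Proof.
apply/funext => u; apply/funext => w; rewrite /penalized /path_process.
by rewrite mulrDr mulrCA maxr_pMr ?expR_ge0// mulr0 mulrBr.
Qed.

Let penalized_half_space beta : 0 < beta ->
  measurable_half_space (fun z => f z + beta * Num.max (G z - wbeta beta z) 0) /\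
  bounded_half_space (fun z => f z + beta * Num.max (G z - wbeta beta z) 0).
Proof.
move=> b0; have [_ [Mw wM] _] := wbetaP b0.
split.
  apply: measurable_funD; first exact: mf.
  apply: measurable_funM; first exact: measurable_cst.
  apply: measurable_maxr; last exact: measurable_cst.
  by apply: measurable_funB; [exact: mG|exact: wbeta_measurable].
have [_ [Mf fM]] := f_Cb; have [_ [MG GM]] := G_Cb.
exists (Mf + beta * (MG + Mw)) => s x s0.
have mx0 : 0 <= Num.max (G (s, x) - wbeta beta (s, x)) 0 by rewrite le_max lexx orbT.
rewrite (le_trans (ler_normD _ _))// lerD ?fM// normrM gtr0_norm//.
rewrite ler_wpM2l ?(ltW b0)// (ger0_norm mx0) ge_max.
have Gs := GM s x s0; have ws := wM s x s0.
rewrite (le_trans (ler_norm _)) ?(le_trans (ler_normB _ _)) ?lerD//=.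
by rewrite addr_ge0//; [exact: le_trans (normr_ge0 _) Gs|exact: le_trans (normr_ge0 _) ws].
Qed.

Lemma wbeta_dynamics beta s x : 0 < beta -> 0 <= s ->
  dynamics (P x) F T (term s)
    (penalized (path f s) (path G s) (path (wbeta beta) s) beta)
    (path (wbeta beta) s).
Proof.
move=> b0 s0; have [_ bw wE] := wbetaP b0.
have [mg bg] := penalized_half_space b0.
rewrite -path_penalized.
exact: (markov_dynamics smp oO alpha_gt0 mg bg mH H_Cb.2 (wbeta_measurable b0) bw wE x s0).
Qed.

Lemma wbetaE beta s x : 0 < beta -> 0 <= s -> wbeta beta (s, x) = \int[P x]_w
  (Itg (penalized (path f s) (path G s) (path (wbeta beta) s) beta ^~ w) 0 (T w) +
   term s w).
Proof.
move=> b0 s0; have [_ bw wE] := wbetaP b0.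
have [mg bg] := penalized_half_space b0.
rewrite -path_penalized.
exact: (value_announced smp oO alpha_gt0 mg bg mH H_Cb.2 wE x s0).
Qed.

Lemma J_pay s x tau : 0 <= s -> stopping_time F tau ->
  J P X O alpha f G H s x tau = \int[P x]_w pay T (term s) (path f s) (path G s) 0 tau w.
Proof.
move=> s0 st; have ste := exit_time_stopping smp oO.
have me := stopping_time_measurable filF ste.
have bhe := terminal_bm mX rcX alpha_gt0 s0 mH H_Cb.2 me ste.1.
have mtau := stopping_time_measurable filF st.
transitivity (\int[P x]_w pay (exit_time X O)
    (fun w => terminal X alpha H s (exit_time X O w) w) (path f s) (path G s) 0 tau w).
  apply: eq_Rintegral => w _; rewrite /pay (running_Itg mX rcX alpha_gt0)//; last exact: f_Cb.2.
  congr (_ + _); case: ifPn => // te; rewrite terminalE; last exact: st.1.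
  by rewrite (lt_le_trans te (leey _)).
apply: Rintegral_ae.
- exact: (bm_pay alpha_gt0 filF ste bhe (process_f s0) (process_G s0) (lexx 0) mtau st.1).
- exact: (bm_pay alpha_gt0 filF stT (bmh s0) (process_f s0) (process_G s0) (lexx 0) mtau st.1).
- by apply: filterS (exit_time_ae smp oO x) => w; rewrite /pay => ->.
Qed.

Lemma adapted_lt beta s u : 0 < beta -> 0 <= s -> 0 <= u ->
  F u [set w | path G s u w < path (wbeta beta) s u w].
Proof.
move=> b0 s0 u0.
have mS phi : measurable_half_space phi ->
    measurable_fun setT (fun y : borel E => expR (- alpha * u) * phi (s + u, y)).
  move=> mphi; apply: measurable_funM; first exact: measurable_cst.
  have := measurableT_comp mphi (measurable_fun_pair
    (measurable_cst (s + u : measurableTypeR R)) (@measurable_id _ (borel E) setT)).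
  by apply: eq_measurable_fun => y _ /=; rewrite max_l// addr_ge0.
have := measurable_fun_ltr (mS _ mG) (mS _ (wbeta_measurable b0)) measurableT.
move=> /(_ [set true] I); rewrite setTI => /(smp_adapted smp u0).
by congr F; apply/seteqP; split => w /=; rewrite !path_processE.
Qed.

(** [comparison_step] contracts a bound on the difference by [q], starting from the trivial bound
    [M]. The induction runs over all starting points at once, because the bound is used at the later
    points [(r + u, X u)]. *)
Lemma wbeta_homo b1 b2 s x : 0 < b1 -> b1 <= b2 -> 0 <= s ->
  wbeta b1 (s, x) <= wbeta b2 (s, x).
Proof.
move=> b10 b12 s0; have b20 : 0 < b2 by exact: lt_le_trans b12.
have [q /andP[q0 q1] sel] := exists_discounted_time alpha_gt0 b10.
have [_ [M1 w1M] _] := wbetaP b10; have [_ [M2 w2M] _] := wbetaP b20.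
pose M := `|M1| + `|M2| + 1.
have M0 : 0 < M by rewrite ltr_wpDl// addr_ge0.
have main n r y : 0 <= r -> wbeta b1 (r, y) - wbeta b2 (r, y) <= M * q ^+ n.
  elim: n r y => [|n IH] r y r0.
    rewrite expr0 mulr1 (le_trans (ler_norm _))// (le_trans (ler_normB _ _))//.
    rewrite /M -[leLHS]addr0 lerD// lerD//.
      by rewrite (le_trans (w1M _ _ r0))// ler_norm.
    by rewrite (le_trans (w2M _ _ r0))// ler_norm.
  have delta0 : 0 < M * q ^+ n by rewrite mulr_gt0// exprn_gt0.
  rewrite wbetaE// [X in _ - X]wbetaE// exprSr mulrA mulrC.
  apply: (comparison_step alpha_gt0 filF stT (bmh r0) (process_f r0) (process_G r0)
    (process_w b10 r0) (process_w b20 r0) b10 b12 (wbeta_dynamics y b10 r0)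
    (wbeta_dynamics y b20 r0) delta0 _ sel).
  move=> u w u0; rewrite !path_processE// -mulrBr mulrC ler_wpM2r ?expR_ge0//.
  by apply: IH; exact: addr_ge0.
rewrite -subr_le0; apply/ler_addgt0Pr => e e0; rewrite add0r.
have q1' : `|q| < 1 by rewrite ger0_norm ?ltW.
have cv : (fun n => M * q ^+ n) @ \oo --> M * 0.
  by apply: cvgM; [exact: cvg_cst|exact: cvg_expr].
rewrite mulr0 in cv; move: cv => /cvgrPdist_lt /(_ e e0)[n _ /(_ n (leqnn n))].
rewrite /= sub0r normrN => Mq; rewrite (le_trans (main n s x s0))// ltW//.
exact: le_lt_trans (ler_norm _) Mq.
Qed.

Let values s x := [set J P X O alpha f G H s x tau | tau in stopping_time F].

(** The real-valued [sup] in [value] is a least upper bound only for a nonempty bounded set;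
    otherwise it is a default value. *)
Lemma values_has_sup s x : 0 <= s -> has_sup (values s x).
Proof.
move=> s0; split.
  by exists (J P X O alpha f G H s x (fun=> 0%:E)), (fun=> 0%:E) => //; exact: stopping_time_cst.
have [C payC] := pay_bounded T alpha_gt0 (bmh s0) (process_f s0) (process_G s0).
exists `|C| => _ [tau st <-]; rewrite J_pay//.
apply: bm_Rintegral_le_cst => //.
  exact: (bm_pay alpha_gt0 filF stT (bmh s0) (process_f s0) (process_G s0) (lexx 0)
    (stopping_time_measurable filF st) st.1).
move=> w _; rewrite (le_trans (ler_norm _))// (le_trans (payC _ st.1 w))//.
exact: ler_norm.
Qed.

Lemma wbeta_le_value beta s x : 0 < beta -> 0 <= s ->
  wbeta beta (s, x) <= value P F X O alpha f G H s x.
Proof.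
move=> b0 s0; apply/ler_addgt0Pr => e e0.
have [tau st le] := near_optimal_stopping alpha_gt0 filF stT (bmh s0) (process_f s0)
  (process_G s0) (process_w b0 s0) b0 (wbeta_dynamics x b0 s0)
  (fun u => adapted_lt b0 s0) e0.
rewrite wbetaE// (le_trans le)// lerD2r -J_pay//.
by apply: (ub_le_sup (values_has_sup x s0).2); exists tau.
Qed.

Lemma J_le_bound s x L tau : 0 <= s -> stopping_time F tau ->
  (forall beta, 0 < beta -> wbeta beta (s, x) <= L) ->
  J P X O alpha f G H s x tau <= L.
Proof.
move=> s0 st leL; rewrite J_pay//.
apply: (mean_pay_le alpha_gt0 filF stT (bmh s0) (process_f s0) (process_G s0)
  (vb := fun beta => path (wbeta beta) s)) => //.
- by move=> beta b0; exact: process_w.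
- by move=> beta b0; exact: wbeta_dynamics.
- by move=> beta b0; rewrite -wbetaE// leL.
- by move=> w t t0; exact: path_process_right_continuous.
Qed.

End penalized_value.

(** * Convergence to the value of the stopping problem *)

Theorem proposition9 (R : realType) (E : pmetricType R)
  (d : measure_display) (Omega : measurableType d)
  (P : E -> probability Omega R) (F : R -> set (set Omega))
  (X : R -> Omega -> E) (theta : R -> Omega -> Omega)
  (O : set E) (alpha : R) (f G H : R * E -> R) (wbeta : R -> R * E -> R)
  (E_locally_compact : locally_compact [set: E])
  (E_separable : separable_space E)
  (E_closed_balls : closed_balls_compact E)
  (X_standard : standard_markov_process P F X theta)
  (X_feller : weakly_feller P X)
  (O_open : open O)
  (alpha_gt0 : 0 < alpha)
  (f_Cb : Cb_half_space f) (G_Cb : Cb_half_space G) (H_Cb : Cb_half_space H)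
  (wbetaP : forall beta : R, 0 < beta ->
     penalized_solution P X O alpha f G H beta (wbeta beta))
  (killed_feller : forall t : R, 0 < t -> forall h : E -> R,
     Cb h -> Cb (killed_semigroup P X O t h)) :
  forall (s : R) (x : E), 0 <= s ->
    (forall b1 b2 : R, 0 < b1 -> b1 <= b2 ->
       wbeta b1 (s, x) <= wbeta b2 (s, x)) /\
    wbeta beta (s, x) @[beta --> +oo] --> value P F X O alpha f G H s x.
Proof.
move=> s x s0; split => [b1 b2 b10 b12|].
  exact: (wbeta_homo X_standard O_open alpha_gt0 f_Cb G_Cb H_Cb wbetaP).
set V := value _ _ _ _ _ _ _ _ _ _.
have wV beta : 0 < beta -> wbeta beta (s, x) <= V.
  by move=> b0; exact: (wbeta_le_value X_standard O_open alpha_gt0 f_Cb G_Cb H_Cb wbetaP).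
apply/cvgrPdist_le => e e0.
(* Otherwise [V - e] would bound every [wbeta beta (s, x)], hence every [J] by [J_le_bound], against
   the definition of [V] as a supremum. *)
have [beta0 [b0 wb0]] : exists beta0, 0 < beta0 /\ V - e < wbeta beta0 (s, x).
  apply: contrapT => /forallNP no.
  have supJ := values_has_sup X_standard O_open alpha_gt0 f_Cb G_Cb H_Cb x s0.
  have [_ [tau st <-]] := sup_adherent e0 supJ.
  rewrite -/V ltNge => /negP; apply.
  apply: (J_le_bound X_standard O_open alpha_gt0 f_Cb G_Cb H_Cb wbetaP) => // beta b0.
  by rewrite leNgt; apply/negP => h; apply: (no beta).
near=> beta.
have bb : beta0 <= beta by near: beta; apply: nbhs_pinfty_ge; exact: num_real.
have w1 : wbeta beta0 (s, x) <= wbeta beta (s, x).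
  exact: (wbeta_homo X_standard O_open alpha_gt0 f_Cb G_Cb H_Cb wbetaP).
have w2 := wV beta (lt_le_trans b0 bb).
by rewrite ger0_norm ?subr_ge0//; lra.
Unshelve. all: by end_near. Qed.
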